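(* For $\mathcal{EL}_\bot$ weighted knowledge bases, the problems $\mathsf{I}^{p}_{b}$ and $\mathsf{I}^{c}_{b}$ (bounded-cost possible and certain instance query entailment) are ExpTime-hard in combined complexity, even if the bound $k$ and the weights are encoded in unary.
   Context: Fix pairwise disjoint countably infinite sets $\mathsf{N_C}$, $\mathsf{N_R}$, $\mathsf{N_I}$ of concept, role and individual names. $\mathcal{EL}_\bot$ concepts: $C ::= A \mid \top\mid\bot\mid C\sqcap C\mid \exists R.C$. A TBox is a finite set of concept inclusions $C\sqsubseteq D$; an ABox is a finite set of assertions $A(a)$, $R(a,b)$. Interpretations $\mathcal I=(\Delta^{\mathcal I},\cdot^{\mathcal I})$ have the usual semantics under a weak standard names assumption: individual names occurring in the input are interpreted as themselves, $a^{\mathcal I}=a\in\Delta^{\mathcal I}$. A weighted knowledge base (WKB) is $\mathcal K_\omega=(\langle\mathcal T,\mathcal A\rangle,\omega)$ with $\omega:\mathcal T\cup\mathcal A\to\mathbb N_{>0}\cup\{\infty\}$. For $\tau=B\sqsubseteq C$ let $\mathrm{vio}_\tau(\mathcal I)=(B\sqcap\neg C)^{\mathcal I}$ and $\mathrm{vio}_{\mathcal A}(\mathcal I)=\{\alpha\in\mathcal A\mid\mathcal I\not\models\alpha\}$. $\mathrm{cost}_{\mathcal K_\omega}(\mathcal I)=\sum_{\tau\in\mathcal T}\omega(\tau)|\mathrm{vio}_\tau(\mathcal I)|+\sum_{\alpha\in\mathrm{vio}_{\mathcal A}(\mathcal I)}\omega(\alpha)$ (summands with empty violation set are $0$; cost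 $\infty$ if an infinite-weight element is violated or some violation set is infinite). An instance query is a Boolean query consisting of a single atom $A(t)$ or $R(t,t')$ (terms: individual names or existentially quantified variables); $\mathcal I\models q$ iff some map from terms to $\Delta^{\mathcal I}$, identity on individuals, makes the atom true. $\mathcal K_\omega\models^c_k q$ iff every $\mathcal I$ with cost $\le k$ satisfies $q$; $\mathcal K_\omega\models^p_k q$ iff some such $\mathcal I$ satisfies $q$. $\mathsf I^c_b$ (resp. $\mathsf I^p_b$): given $\mathcal K_\omega$, instance query $q$, integer $k$, decide $\mathcal K_\omega\models^c_k q$ (resp. $\models^p_k$). Combined complexity measures in the size of the whole input. *)

(* Defs.v *)
From HB Require Import structures.
From mathcomp Require Import all_boot all_order all_algebra.
From mathcomp Require Import boolp classical_sets cardinality.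
From mathcomp Require Import constructive_ereal.

Set Implicit Arguments.
Unset Strict Implicit.
Unset Printing Implicit Defensive.

Import Order.TTheory GRing.Theory Num.Theory.

Local Open Scope classical_set_scope.

Definition word := seq bool.
Definition language := word -> Prop.

(** * Deterministic Turing machines *)

(* A tape is two-way infinite: the cells left of the head (nearest first), the
   scanned cell, the cells right of the head; all other cells are blank. *)
Record tape (symbol : Type) := Tape {
  tape_left : seq symbol;
  tape_head : symbol;
  tape_right : seq symbol
}.

Inductive move := MoveLeft | Stay | MoveRight.

(* [tm k] is the type of machines with [k.+1] tapes. The tape alphabet is
   [option (bool + aux)]: [None] is the blank, [Some (inl b)] the input/output
   bit [b], and [Some (inr _)] an auxiliary symbol. The machine halts when
   [delta] returns [None]. *)
Record tm (k : nat) := TM {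
  state : finType;
  aux : finType;
  start : state;
  accepting : pred state;
  delta : state -> {ffun 'I_k.+1 -> option (bool + aux)} ->
    option (state * ('I_k.+1 -> option (bool + aux) * move))
}.

Section Machine.
Variables (k : nat) (M : tm k).

Definition symbol := option (bool + aux M).
Definition blank : symbol := None.
Definition bit (b : bool) : symbol := Some (inl b).

Definition move_tape (m : move) (t : tape symbol) : tape symbol :=
  let: Tape l c r := t in
  match m with
  | MoveLeft => Tape (behead l) (head blank l) (c :: r)
  | Stay => t
  | MoveRight => Tape (c :: l) (head blank r) (behead r)
  end.

Definition write_tape (a : symbol) (t : tape symbol) : tape symbol :=
  Tape (tape_left t) a (tape_right t).

Record config := Config {
  config_state : state M;
  config_tapes : 'I_k.+1 -> tape symbol
}.

Definition next (c : config) :=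
  delta (config_state c) [ffun i => tape_head (config_tapes c i)].

Definition halted (c : config) : bool := ~~ isSome (next c).

Definition step (c : config) : config :=
  if next c is Some (q, act) then
    Config q (fun i =>
      move_tape (act i).2 (write_tape (act i).1 (config_tapes c i)))
  else c.

Definition input_tape (w : word) : tape symbol :=
  Tape [::] (head blank (map bit w)) (behead (map bit w)).

Definition init (w : word) : config :=
  Config (start M)
    (fun i => if i == ord0 then input_tape w else Tape [::] blank [::]).

(* The output is the block of non-blank symbols on the last tape that starts
   at the head. *)
Definition output (c : config) : seq symbol :=
  let t := config_tapes c ord_max in
  let s := tape_head t :: tape_right t in
  take (index blank s) s.

Definition halts_within (T : nat) (w : word) (c : config) : Prop :=
  c = iter T step (init w) /\ halted c.

Definition decides_in_time (T : nat -> nat) (L : language) : Prop :=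
  forall w, exists2 c, halts_within (T (size w)) w c &
    (L w <-> accepting (config_state c)).

Definition computes_in_time (T : nat -> nat) (f : word -> word) : Prop :=
  forall w, exists2 c, halts_within (T (size w)) w c &
    output c = map bit (f w).

End Machine.

(** * Exponential-time hardness *)

(* Every polynomial is bounded by one of the form [n ^ d + d]. *)
Definition polytime_computable (f : word -> word) : Prop :=
  exists k (M : tm k) d, computes_in_time M (fun n => n ^ d + d)%N f.

(* One-tape time; since a multi-tape machine is simulated by a one-tape machine
   with quadratic slowdown, the number of tapes does not affect the class. *)
Definition EXPTIME (L : language) : Prop :=
  exists (M : tm 0) d, decides_in_time M (fun n => 2 ^ (n ^ d + d))%N L.

Definition polytime_reducible (L L' : language) : Prop :=
  exists2 f, polytime_computable f & forall w, L w <-> L' (f w).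

Definition EXPTIME_hard (L : language) : Prop :=
  forall L', EXPTIME L' -> polytime_reducible L' L.

(** * EL_bot weighted knowledge bases *)

(* Names are words. Concept, role and individual names are used in different
   syntactic positions only, so disjointness is implicit. *)
Definition concept_name := word.
Definition role_name := word.
Definition ind_name := word.
Definition var_name := word.

Inductive concept :=
| CName of concept_name
| CTop
| CBot
| CAnd of concept & concept
| CEx of role_name & concept.

Lemma concept_comparable : comparable concept.
Proof. by rewrite /comparable /decidable; decide equality; apply: eq_comparable. Qed.
HB.instance Definition _ := comparableMixin concept_comparable.

(* [(C, D)] is the inclusion of [C] in [D]. *)
Definition inclusion := (concept * concept)%type.

Inductive assertion :=
| AConcept of concept_name & ind_name
| ARole of role_name & ind_name & ind_name.

Lemma assertion_comparable : comparable assertion.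
Proof. by rewrite /comparable /decidable; decide equality; apply: eq_comparable. Qed.
HB.instance Definition _ := comparableMixin assertion_comparable.

Inductive weight := Fin of nat | Inf.

Definition positive_weight (w : weight) : bool :=
  if w is Fin n then (0 < n)%N else true.

(* The finite sets of axioms and the weight function are given together, as
   duplicate-free lists of weighted axioms. *)
Record wkb := WKB {
  tbox : seq (inclusion * weight);
  abox : seq (assertion * weight);
  tbox_uniq : uniq (unzip1 tbox);
  abox_uniq : uniq (unzip1 abox);
  tbox_pos : all positive_weight (unzip2 tbox);
  abox_pos : all positive_weight (unzip2 abox)
}.

Inductive term := TInd of ind_name | TVar of var_name.

(* All variables are existentially quantified. *)
Inductive instance_query :=
| QConcept of concept_name & term
| QRole of role_name & term & term.

Definition assertion_inds (al : assertion) : seq ind_name :=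
  match al with
  | AConcept _ a => [:: a]
  | ARole _ a b => [:: a; b]
  end.

Definition term_inds (t : term) : seq ind_name :=
  if t is TInd a then [:: a] else [::].

Definition query_inds (q : instance_query) : seq ind_name :=
  match q with
  | QConcept _ t => term_inds t
  | QRole _ t u => term_inds t ++ term_inds u
  end.

Definition input_inds (K : wkb) (q : instance_query) : seq ind_name :=
  flatten (map assertion_inds (unzip1 (abox K))) ++ query_inds q.

(** * Semantics *)

(* The domain is a set whose possible elements are the individual names
   ([inl a]) and arbitrary further objects ([inr x]). *)
Record interp := Interp {
  extra : Type;
  dom : set (ind_name + extra);
  cint : concept_name -> set (ind_name + extra);
  rint : role_name -> set ((ind_name + extra) * (ind_name + extra));
  dom_nonempty : dom !=set0;
  cint_dom : forall A, cint A `<=` dom;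
  rint_dom : forall R, rint R `<=` dom `*` dom
}.

Arguments dom : clear implicits.
Arguments cint : clear implicits.
Arguments rint : clear implicits.

Definition elem (I : interp) : Type := (ind_name + extra I)%type.

(* The weak standard names assumption: the individual names of the input are
   elements of the domain, and each is interpreted as itself. *)
Definition standard_names (s : seq ind_name) (I : interp) : Prop :=
  forall a, a \in s -> dom I (inl a).

Section Semantics.
Variable I : interp.

Fixpoint cext (C : concept) : set (elem I) :=
  match C with
  | CName A => cint I A
  | CTop => dom I
  | CBot => set0
  | CAnd C D => cext C `&` cext D
  | CEx R C => [set x | exists y, rint I R (x, y) /\ cext C y]
  end.

Definition sat_assertion (al : assertion) : Prop :=
  match al with
  | AConcept A a => cint I A (inl a)
  | ARole R a b => rint I R (inl a, inl b)
  end.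

Definition vio (tau : inclusion) : set (elem I) :=
  cext tau.1 `&` (dom I `\` cext tau.2).

Definition eval_term (v : var_name -> elem I) (t : term) : elem I :=
  match t with
  | TInd a => inl a
  | TVar x => v x
  end.

Definition sat_query (q : instance_query) : Prop :=
  exists v : var_name -> elem I,
    (forall x, dom I (v x)) /\
    match q with
    | QConcept A t => cint I A (eval_term v t)
    | QRole R t u => rint I R (eval_term v t, eval_term v u)
    end.

End Semantics.

Arguments cext : clear implicits.
Arguments sat_assertion : clear implicits.
Arguments vio : clear implicits.
Arguments sat_query : clear implicits.

Definition weight_value (w : weight) : \bar int :=
  if w is Fin n then (n%:Z)%:E else +oo%E.

(* The number of elements of [A], or [+oo] if [A] is infinite. *)
Definition ecard (T : Type) (A : set T) : \bar int :=
  if pselect (exists n, (A #= `I_n)%card) is left finA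
  then ((projT1 (cid finA))%:Z)%:E else +oo%E.

(* In [\bar int], [+oo * 0 = 0] and [+oo * n = +oo] for [0 < n]. *)
Definition cost (K : wkb) (I : interp) : \bar int :=
  (\sum_(tw <- tbox K) weight_value tw.2 * ecard (vio I tw.1)
   + \sum_(aw <- abox K | `[< ~ sat_assertion I aw.1 >]) weight_value aw.2)%E.

Definition certain (K : wkb) (q : instance_query) (k : int) : Prop :=
  forall I, standard_names (input_inds K q) I ->
    (cost K I <= k%:E)%E -> sat_query I q.

Definition possible (K : wkb) (q : instance_query) (k : int) : Prop :=
  exists I, [/\ standard_names (input_inds K q) I,
    (cost K I <= k%:E)%E & sat_query I q].

(** * Encoding of problem instances as words *)

(* The encoding of the finite weights and of the bound. *)
Inductive numeral := Unary | Binary.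

Definition enc_unary (n : nat) : word := rcons (nseq n true) false.

Definition enc_seq (T : Type) (e : T -> word) (s : seq T) : word :=
  foldr (fun x w => true :: e x ++ w) [:: false] s.

Definition enc_pair (S T : Type) (e : S -> word) (f : T -> word)
  (p : S * T) : word := e p.1 ++ f p.2.

Definition enc_word (w : word) : word := enc_seq (fun b : bool => [:: b]) w.

(* Least significant bit first. *)
Fixpoint bits_of_pos (p : BinNums.positive) : word :=
  match p with
  | BinNums.xH => [:: true]
  | BinNums.xO p => false :: bits_of_pos p
  | BinNums.xI p => true :: bits_of_pos p
  end.

Definition bits_of_nat (n : nat) : word :=
  if bin_of_nat n is BinNums.Npos p then bits_of_pos p else [::].

Definition enc_nat (c : numeral) (n : nat) : word :=
  match c with
  | Unary => enc_unary n
  | Binary => enc_word (bits_of_nat n)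
  end.

Definition enc_int (c : numeral) (z : int) : word :=
  match z with
  | Posz n => false :: enc_nat c n
  | Negz n => true :: enc_nat c n
  end.

Definition enc_weight (c : numeral) (w : weight) : word :=
  match w with
  | Fin n => false :: enc_nat c n
  | Inf => [:: true]
  end.

Fixpoint enc_concept (C : concept) : word :=
  match C with
  | CName A => enc_unary 0 ++ enc_word A
  | CTop => enc_unary 1
  | CBot => enc_unary 2
  | CAnd C D => enc_unary 3 ++ enc_concept C ++ enc_concept D
  | CEx R C => enc_unary 4 ++ enc_word R ++ enc_concept C
  end.

Definition enc_assertion (al : assertion) : word :=
  match al with
  | AConcept A a => false :: enc_word A ++ enc_word a
  | ARole R a b => true :: enc_word R ++ enc_word a ++ enc_word b
  end.

Definition enc_term (t : term) : word :=
  match t with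
  | TInd a => false :: enc_word a
  | TVar x => true :: enc_word x
  end.

Definition enc_query (q : instance_query) : word :=
  match q with
  | QConcept A t => false :: enc_word A ++ enc_term t
  | QRole R t u => true :: enc_word R ++ enc_term t ++ enc_term u
  end.

Definition enc_wkb (c : numeral) (K : wkb) : word :=
  enc_seq (enc_pair (enc_pair enc_concept enc_concept) (enc_weight c)) (tbox K)
  ++ enc_seq (enc_pair enc_assertion (enc_weight c)) (abox K).

Definition enc_instance (c : numeral) (K : wkb) (q : instance_query) (k : int) :
  word := enc_wkb c K ++ enc_query q ++ enc_int c k.

Definition possible_problem (c : numeral) : language :=
  fun w => exists K q k, w = enc_instance c K q k /\ possible K q k.

Definition certain_problem (c : numeral) : language :=
  fun w => exists K q k, w = enc_instance c K q k /\ certain K q k.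

(** * Instances are determined by their encodings *)

Definition prefix_code (T : Type) (e : T -> word) : Prop :=
  forall x y s t, e x ++ s = e y ++ t -> x = y /\ s = t.

Lemma enc_unary_prefix : prefix_code enc_unary.
Proof.
elim=> [|m IHm] [|n] s t //=; first by case.
by case=> /IHm[-> ->].
Qed.

Lemma enc_seq_prefix T (e : T -> word) :
  prefix_code e -> prefix_code (enc_seq e).
Proof.
move=> eP; elim=> [|x xs IH] [|y ys] s t //=; first by case.
by case; rewrite -!catA => /eP[-> /IH[-> ->]].
Qed.

Lemma enc_pair_prefix S T (e : S -> word) (f : T -> word) :
  prefix_code e -> prefix_code f -> prefix_code (enc_pair e f).
Proof.
move=> eP fP [x y] [x' y'] s t; rewrite /enc_pair -!catA /=.
by case/eP=> -> /fP[-> ->].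
Qed.

Lemma enc_word_prefix : prefix_code enc_word.
Proof. by apply: enc_seq_prefix => x y s t [-> ->]. Qed.

Lemma bits_of_pos_inj : injective bits_of_pos.
Proof.
elim=> [p IHp|p IHp|] [q|q|] //=; do ?by case=> /IHp ->.
- by case; case: p {IHp}.
- by case; case: q.
Qed.

Lemma bits_of_nat_inj : injective bits_of_nat.
Proof.
move=> m n; rewrite /bits_of_nat => eq_mn; apply: (can_inj bin_of_natK).
case: (bin_of_nat m) (bin_of_nat n) eq_mn => [|p] [|q] //=.
- by case: q.
- by case: p.
- by move/bits_of_pos_inj->.
Qed.

Lemma enc_nat_prefix c : prefix_code (enc_nat c).
Proof.
case: c => /=; first exact: enc_unary_prefix.
by move=> m n s t /enc_word_prefix[/bits_of_nat_inj-> ->].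
Qed.

Lemma enc_int_prefix c : prefix_code (enc_int c).
Proof. by move=> [m|m] [n|n] s t //= [] /enc_nat_prefix[-> ->]. Qed.

Lemma enc_weight_prefix c : prefix_code (enc_weight c).
Proof. by move=> [m|] [n|] s t //= []; [case/enc_nat_prefix=> -> -> | move->]. Qed.

Lemma enc_concept_prefix : prefix_code enc_concept.
Proof.
elim=> [A|||C IHC D IHD|R C IHC] [B|||C' D'|R' C'] s t //=.
- by case=> /enc_word_prefix[-> ->].
- by case.
- by case.
- by case; rewrite -!catA => /IHC[-> /IHD[-> ->]].
- by case; rewrite -!catA => /enc_word_prefix[-> /IHC[-> ->]].
Qed.

Lemma enc_assertion_prefix : prefix_code enc_assertion.
Proof.
move=> [A a|R a b] [A' a'|R' a' b'] s t //= []; rewrite -!catA.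
- by case/enc_word_prefix=> -> /enc_word_prefix[-> ->].
- by case/enc_word_prefix=> -> /enc_word_prefix[-> /enc_word_prefix[-> ->]].
Qed.

Lemma enc_term_prefix : prefix_code enc_term.
Proof. by move=> [a|x] [b|y] s t //= [] /enc_word_prefix[-> ->]. Qed.

Lemma enc_query_prefix : prefix_code enc_query.
Proof.
move=> [A x|R x y] [A' x'|R' x' y'] s t //= []; rewrite -!catA.
- by case/enc_word_prefix=> -> /enc_term_prefix[-> ->].
- by case/enc_word_prefix=> -> /enc_term_prefix[-> /enc_term_prefix[-> ->]].
Qed.

Lemma enc_wkb_prefix c : prefix_code (enc_wkb c).
Proof.
move=> [T A uT uA pT pA] [T' A' uT' uA' pT' pA'] s t; rewrite /enc_wkb -!catA /=.
have CP := enc_pair_prefix enc_concept_prefix enc_concept_prefix.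
case/(enc_seq_prefix (enc_pair_prefix CP (@enc_weight_prefix c))) => eT.
case/(enc_seq_prefix (enc_pair_prefix enc_assertion_prefix
  (@enc_weight_prefix c))) => eA ->.
subst T' A'; split=> //.
by congr WKB; apply: bool_irrelevance.
Qed.

Lemma enc_instance_inj c K q k K' q' k' :
  enc_instance c K q k = enc_instance c K' q' k' ->
  [/\ K = K', q = q' & k = k'].
Proof.
rewrite /enc_instance => /enc_wkb_prefix[-> /enc_query_prefix[-> ekk']].
have: enc_int c k ++ [::] = enc_int c k' ++ [::] by rewrite ekk'.
by case/enc_int_prefix=> ->.
Qed.

(* Main.v *)
(* A concept [U] with the soft axiom [U <= bot] of weight 1, two individuals
   asserted to be in [U], and the bound 2 leave [U] with exactly these two
   elements, everything else being hard. A successor in [U] is then a choice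
   between two values, which gives every element guessed bits.

   With these bits each element carries a time counter and a position counter.
   Successors along the roles [P], [D], [E] decrease the time, decrease the
   position and increase the position, and labels for the symbol in the cell
   [position] of the tape of a given exponential-time machine at the instant
   [time] are derived upwards from the successors, starting from the input at
   time 0. Positions are relative to the head and taken modulo a power of two
   that exceeds twice the running time, so the labels are forced to be correct.
   A hard axiom excludes the unwanted final states at late times: there is a
   model of cost at most 2 iff the machine gives the wanted verdict. The query
   is a fresh concept name, hence possible iff such a model exists and certain
   iff there is none, and either verdict may be asked for.

   The knowledge base consists of a few templates repeated for each bit and for
   each input letter, so that nested loops over the input write it down. *)

From HB Require Import structures.
From mathcomp Require Import all_boot all_order all_algebra.
From mathcomp Require Import boolp classical_sets cardinality constructive_ereal.
From mathcomp Require Import zify.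
Require Import Defs.

Set Implicit Arguments.
Unset Strict Implicit.
Unset Printing Implicit Defensive.

Import Order.TTheory GRing.Theory Num.Theory.

(** * Structured programs for multi-tape machines *)

Section Programs.
Variable k : nat.

Definition sym := option (bool + void).
(** Cells are indexed relative to the head, which scans cell 0; moving the head shifts the
    function. *)
Definition track := int -> sym.
Definition store := 'I_k.+1 -> track.

(** A flow graph: an instruction sees all scanned symbols and returns the next point, [None] being
    the exit, and at most one write and move on a single tape. Explicit exits let programs be
    plugged together. *)
Record prog := Prog {
  point : finType;
  entry : point;
  instr : point -> ('I_k.+1 -> sym) ->
    option point * option ('I_k.+1 * sym * move)
}.

Definition shift (m : move) (f : track) : track := fun z =>
  match m with
  | MoveLeft => f (z - 1)%R
  | Stay => f z
  | MoveRight => f (z + 1)%R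
  end.

Definition put (a : sym) (f : track) : track :=
  fun z => if z == 0%R then a else f z.

Definition upd (s : store) i (f : track) : store :=
  fun j => if j == i then f else s j.

Definition act (o : option ('I_k.+1 * sym * move)) (s : store) : store :=
  if o is Some (i, a, m) then upd s i (shift m (put a (s i))) else s.

Definition heads (s : store) : 'I_k.+1 -> sym := fun i => s i 0%R.

Inductive runs_from (A : prog) : point A -> store -> nat -> store -> Prop :=
| RunsExit x s t o : instr x (heads s) = (None, o) ->
    runs_from x s t.+1 (act o s)
| RunsGo x y s t o s' : instr x (heads s) = (Some y, o) ->
    runs_from y (act o s) t s' -> runs_from x s t.+1 s'.

(* [t] is an upper bound on the running time. *)
Definition runs (A : prog) := runs_from (entry A).

Lemma runs_from_le A (x : point A) s t s' t' :
  runs_from x s t s' -> t <= t' -> runs_from x s t' s'.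
Proof.
move=> r; elim: r t' => {x s t s'} [x s t o e|x y s t o s' e _ IH] [|t'] //.
  by move=> _; apply: RunsExit.
by rewrite ltnS => /IH; apply: RunsGo.
Qed.

Lemma runs_le A s t s' t' : runs A s t s' -> t <= t' -> runs A s t' s'.
Proof. exact: runs_from_le. Qed.

(** * Program constructors and their running times *)

Definition op (i : 'I_k.+1) (f : sym -> sym) (m : move) : prog :=
  @Prog unit tt (fun _ h => (None, Some (i, f (h i), m))).

Definition skip : prog := @Prog unit tt (fun _ _ => (None, None)).

Definition pseq (A B : prog) : prog :=
  @Prog (point A + point B)%type (inl (entry A)) (fun x h =>
    match x with
    | inl x => let: (y, o) := instr x h in
        (Some (if y is Some y then inl y else inr (entry B)), o)
    | inr x => let: (y, o) := instr x h in (omap inr y, o)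
    end).

Definition pif (i : 'I_k.+1) (b : pred sym) (A B : prog) : prog :=
  @Prog (option (point A + point B))%type None (fun x h =>
    match x with
    | None =>
        (Some (Some (if b (h i) then inl (entry A) else inr (entry B))), None)
    | Some (inl x) => let: (y, o) := instr x h in (omap (Some \o inl) y, o)
    | Some (inr x) => let: (y, o) := instr x h in (omap (Some \o inr) y, o)
    end).

(** The symbol [h i] is coerced to a Boolean: the loop goes on while tape [i] scans a non-blank
    symbol. *)
Definition pwhile (i : 'I_k.+1) (A : prog) : prog :=
  @Prog (option (point A)) None (fun x h =>
    if x is Some x then let: (y, o) := instr x h in (Some y, o)
    else (if h i then Some (Some (entry A)) else None, None)).

Lemma runs_op i f m s :
  runs (op i f m) s 1 (upd s i (shift m (put (f (s i 0%R)) (s i)))).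
Proof. by rewrite -[upd _ _ _]/(act (Some (i, f (s i 0%R), m)) s); apply: RunsExit. Qed.

Lemma runs_skip s : runs skip s 1 s.
Proof. by rewrite -{2}[s]/(act None s); apply: RunsExit. Qed.

Lemma runs_seq A B s t s' t' s'' :
  runs A s t s' -> runs B s' t' s'' -> runs (pseq A B) s (t + t') s''.
Proof.
move=> rA rB; rewrite /runs /=.
have inrP x s1 t1 s2 :
    runs_from (x : point B) s1 t1 s2 -> runs_from (inr x : point (pseq A B)) s1 t1 s2.
  elim=> {x s1 t1 s2} [x s1 t1 o e|x y s1 t1 o s2 e _ IH].
    by apply: RunsExit; rewrite /= e.
  by apply: RunsGo IH; rewrite /= e.
elim: rA rB => {s t s'} [x s t o e|x y s t o s' e _ IH] rB.
  rewrite addSn; apply: (@RunsGo (pseq A B) _ (inr (entry B)) _ _ o).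
    by rewrite /= e.
  by apply: inrP; apply: runs_from_le rB (leq_addl _ _).
by rewrite addSn; apply: RunsGo (IH rB); rewrite /= e.
Qed.

Lemma runs_if i (b : pred sym) A B s t s' :
  runs (if b (s i 0%R) then A else B) s t s' -> runs (pif i b A B) s t.+1 s'.
Proof.
rewrite /runs => r.
apply: (@RunsGo (pif i b A B) None _ s t None s') => //=; rewrite /heads.
case: ifP r => _ r.
  move: (entry A) r => x; elim=> {x s t s'} [x s t o e|x y s t o s' e _ IH].
    by apply: RunsExit; rewrite /= e.
  by apply: RunsGo IH; rewrite /= e.
move: (entry B) r => x; elim=> {x s t s'} [x s t o e|x y s t o s' e _ IH].
  by apply: RunsExit; rewrite /= e.
by apply: RunsGo IH; rewrite /= e.
Qed.

Lemma runs_while_stop i A (s : store) : ~~ s i 0%R -> runs (pwhile i A) s 1 s.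
Proof.
move=> b; rewrite -{2}[s]/(act None s).
by apply: RunsExit; rewrite /= /heads (negPf b).
Qed.

Lemma runs_while_next i A (s : store) t s' t' s'' : s i 0%R ->
  runs A s t s' -> runs (pwhile i A) s' t' s'' ->
  runs (pwhile i A) s (t + t').+1 s''.
Proof.
move=> b rA rW; apply: (@RunsGo (pwhile i A) _ (Some (entry A)) _ _ None).
  by rewrite /= /heads b.
rewrite /=; elim: rA rW {b} => {s t s'} [x s t o e|x y s t o s' e _ IH] rW.
  rewrite addSn; apply: (@RunsGo (pwhile i A) _ None _ _ o).
    by rewrite /= e.
  by apply: runs_from_le rW (leq_addl _ _).
by rewrite addSn; apply: RunsGo (IH rW); rewrite /= e.
Qed.

(** [St a] is the store after [a] rounds and plays the part of the loop invariant. Each round pays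
    one step for the test, and so does the exit. *)
Lemma runs_while i A (St : nat -> store) n t :
  (forall a, a < n -> St a i 0%R) -> ~~ St n i 0%R ->
  (forall a, a < n -> runs A (St a) t (St a.+1)) ->
  runs (pwhile i A) (St 0) (n * t.+1).+1 (St n).
Proof.
move=> go stop body.
(* The loop unfolds at its front, so the induction is on the number [m] of rounds that remain. *)
have H m : m <= n -> runs (pwhile i A) (St (n - m)) (m * t.+1).+1 (St n).
  elim: m => [|m IH] lemn; first by rewrite subn0; apply: runs_while_stop.
  have lt : n - m.+1 < n by lia.
  rewrite mulSn addSn -addnS; apply: (runs_while_next (go _ lt) (body _ lt)).
  have -> : (n - m.+1).+1 = n - m by lia.
  by apply: IH; lia.
by have := H n (leqnn n); rewrite subnn.
Qed.

(* The head is on the first symbol of [r]; [l] is read away from the head. Tapes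
   that differ by trailing blanks give the same function. *)
Definition tp (l r : seq sym) : track := fun z =>
  match z with
  | Posz i => nth None r i
  | Negz i => nth None l i
  end.

Lemma shift_left l r : shift MoveLeft (tp l r) = tp (behead l) (head None l :: r).
Proof.
by apply/funext=> [[[|[|i]]|[|i]]];
  rewrite /shift /= -?nth0 ?nth_behead ?addn0.
Qed.

Lemma shift_right l r : shift MoveRight (tp l r) = tp (head None r :: l) (behead r).
Proof.
by apply/funext=> [[i|[|i]]]; rewrite /shift /= -?nth0 ?nth_behead ?addn1 ?subn1 ?subn0.
Qed.

Lemma put_tp a l r : put a (tp l r) = tp l (a :: behead r).
Proof. by apply/funext=> [[[|i]|i]] //=; rewrite /put /= nth_behead. Qed.

(** * Compilation of programs into machines *)

Definition tm_of (A : prog) : tm k :=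
  @TM k (option (point A)) void (Some (entry A)) (fun=> true)
    (fun x h => if x is Some p then
      let: (y, o) := instr p h in
      Some (y, fun i => if o is Some (j, a, m) then
                          if i == j then (a, m) else (h i, Stay)
                        else (h i, Stay))
      else None).

Definition track_of (t : tape sym) : track :=
  tp (tape_left t) (tape_head t :: tape_right t).

Lemma track_of_step A m a (t : tape (symbol (tm_of A))) :
  track_of (move_tape m (write_tape a t)) = shift m (put a (track_of t)).
Proof.
case: t => l c r; rewrite /track_of put_tp; case: m => //=.
  by rewrite shift_left.
rewrite shift_right /=; case: r => //=.
by apply/funext=> [[[|i]|i]] /=; rewrite ?nth_nil.
Qed.

(** One instruction is one machine step; tapes without an action get their scanned symbol rewritten.
    The state [None] halts and is fixed by [step], so an upper bound on the running time is as good
    as the exact one. *)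
Lemma runs_from_tm A (x : point A) s t s' (c : config (tm_of A)) :
  runs_from x s t s' -> config_state c = Some x ->
  (forall i, track_of (config_tapes c i) = s i) ->
  let c' := iter t (@step _ (tm_of A)) c in
  halted c' /\ forall i, track_of (config_tapes c' i) = s' i.
Proof.
have upd_of (d : config (tm_of A)) s1 y z o :
    config_state d = Some y ->
    (forall i, track_of (config_tapes d i) = s1 i) ->
    instr y (heads s1) = (z, o) ->
    config_state (step d) = z /\
    forall i, track_of (config_tapes (step d) i) = act o s1 i.
  move=> eq_d eq_t eq_o.
  have heq : next d = Some (z, fun i => if o is Some (j, a, m) then
      if i == j then (a, m) else (heads s1 i, Stay) else (heads s1 i, Stay)).
    rewrite /next eq_d /=; set F := finfun _.
    have -> : (F : _ -> _) = heads s1.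
      by apply/funext=> i; rewrite ffunE /heads -eq_t.
    by rewrite eq_o.
  rewrite /step heq; split=> // i; rewrite [config_tapes _]/= track_of_step.
  case: o {eq_o heq} => [[[j a] m]|] /=; last first.
    rewrite eq_t; apply/funext=> u; rewrite /shift /put.
    by case: eqP => // ->.
  rewrite /upd; case: eqP => [->|_] /=; first by rewrite eq_t.
  rewrite eq_t; apply/funext=> u; rewrite /shift /put.
  by case: eqP => // ->.
have stay (d : config (tm_of A)) n : config_state d = None ->
    iter n (@step _ (tm_of A)) d = d.
  by move=> eq_d; elim: n => //= n ->; rewrite /step /next eq_d.
move=> r; elim: r c => {x s t s'} [x s t o e|x y s t o s' e _ IH] c eq_c eq_t.
  have [h1 h2] := upd_of c s x None o eq_c eq_t e.
  by rewrite iterSr (stay _ _ h1) /halted /next h1.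
have [h1 h2] := upd_of c s x (Some y) o eq_c eq_t e.
by rewrite iterSr; apply: IH.
Qed.

(** * Trailing blanks and head movements *)

Lemma tp_blank_left l r : tp (rcons l None) r = tp l r.
Proof.
apply/funext=> [[i|i]] //=; rewrite nth_rcons; case: ltnP => // h.
by rewrite if_same nth_default.
Qed.

Lemma tp_blank_right l r : tp l (rcons r None) = tp l r.
Proof.
apply/funext=> [[i|i]] //=; rewrite nth_rcons; case: ltnP => // h.
by rewrite if_same nth_default.
Qed.

Lemma head_tp l r : tp l r 0%R = head None r.
Proof. by case: r. Qed.

Lemma updE s i f : upd s i f i = f.
Proof. by rewrite /upd eqxx. Qed.

Lemma upd_neq s i j f : j != i -> upd s i f j = s j.
Proof. by rewrite /upd => /negPf ->. Qed.

Lemma upd_upd s i f g : upd (upd s i f) i g = upd s i g.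
Proof. by apply/funext=> j; rewrite /upd; case: eqP. Qed.

Lemma upd_id s i f : s i = f -> upd s i f = s.
Proof. by move=> e; apply/funext=> j; rewrite /upd; case: eqP => // ->. Qed.

Lemma upd_comm s i j f g : i != j -> upd (upd s i f) j g = upd (upd s j g) i f.
Proof.
move=> ne; apply/funext=> x; rewrite /upd; case: eqP => // ->.
by rewrite eq_sym (negPf ne).
Qed.

Definition goleft i := op i id MoveLeft.
Definition goright i := op i id MoveRight.
(** The head may stand on the blank after the block, hence the first step left outside the loop; the
    loop ends on the blank before the block. *)
Definition rewind i := pseq (goleft i) (pseq (pwhile i (goleft i)) (goright i)).

Lemma put_head l r : put (head None r) (tp l r) = tp l r.
Proof. by rewrite put_tp; case: r => //=; apply: (tp_blank_right _ [::]). Qed.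

Lemma runs_goleft s i l r : s i = tp l r ->
  runs (goleft i) s 1 (upd s i (tp (behead l) (head None l :: r))).
Proof. by move=> e; have := runs_op i id MoveLeft s; rewrite e head_tp put_head shift_left. Qed.

Lemma runs_goright s i l r : s i = tp l r ->
  runs (goright i) s 1 (upd s i (tp (head None r :: l) (behead r))).
Proof. by move=> e; have := runs_op i id MoveRight s; rewrite e head_tp put_head shift_right. Qed.

Lemma runs_rewind s i l r : s i = tp l r -> all isSome l ->
  runs (rewind i) s (2 * size l + 3) (upd s i (tp [::] (rev l ++ r))).
Proof.
move=> e al.
pose St a := upd s i (tp (drop a.+1 l) (nth None l a :: rev (take a l) ++ r)).
have r1 : runs (goleft i) s 1 (St 0).
  by have := runs_goleft e; rewrite /St take0 drop1 nth0.
have r2 : runs (pwhile i (goleft i)) (St 0) (size l * 2).+1 (St (size l)).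
  apply: runs_while => [a lt|/=|a lt].
  - by rewrite /St updE head_tp /=; apply: (all_nthP None al).
  - by rewrite /St updE head_tp /= nth_default.
  have := @runs_goleft (St a) i _ _ (updE _ _ _).
  rewrite /St upd_upd -drop1 drop_drop add1n -nth0 nth_drop addn0.
  by rewrite (take_nth None) // rev_rcons.
have r3 : runs (goright i) (St (size l)) 1 (upd s i (tp [::] (rev l ++ r))).
  have := @runs_goright (St (size l)) i _ _ (updE _ _ _).
  rewrite /St upd_upd take_size drop_oversize //= nth_default //.
  by rewrite (tp_blank_left [::]).
by apply: runs_le (runs_seq r1 (runs_seq r2 r3)) _; lia.
Qed.

End Programs.

(** * A machine writing repeated templates *)

Definition poly_bounded (f : nat -> nat) : Prop :=
  exists d, forall n, f n <= (n + 2) ^ d.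

Lemma poly_bounded_const a : poly_bounded (fun=> a).
Proof.
exists a => n; case: a => // a.
apply: leq_trans (ltnW (ltn_expl a.+1 (isT : 1 < 2))) _.
by rewrite leq_exp2r ?leq_addl.
Qed.

Lemma poly_bounded_exp d : poly_bounded (fun n => (n + 2) ^ d).
Proof. by exists d. Qed.

Lemma poly_bounded_mul f g :
  poly_bounded f -> poly_bounded g -> poly_bounded (fun n => f n * g n).
Proof. by move=> [a Ha] [b Hb]; exists (a + b) => n; rewrite expnD leq_mul. Qed.

Lemma poly_bounded_add f g :
  poly_bounded f -> poly_bounded g -> poly_bounded (fun n => f n + g n).
Proof.
move=> [a Ha] [b Hb]; exists (a + b).+1 => n.
have n0 : 0 < n + 2 by rewrite addn2.
have ha : (n + 2) ^ a <= (n + 2) ^ (a + b) by rewrite leq_pexp2l ?leq_addr.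
have hb : (n + 2) ^ b <= (n + 2) ^ (a + b) by rewrite leq_pexp2l ?leq_addl.
rewrite expnS; apply: (@leq_trans (2 * (n + 2) ^ (a + b))); last first.
  by rewrite leq_mul2r leq_addl orbT.
by rewrite mul2n -addnn leq_add // (leq_trans (Ha n), leq_trans (Hb n)).
Qed.

Lemma poly_bounded_succ f : poly_bounded f -> poly_bounded (fun n => (f n).+1).
Proof.
move=> hf; have [d hd] := poly_bounded_add hf (poly_bounded_const 1).
by exists d => n; rewrite -addn1.
Qed.

Lemma poly_bounded_id : poly_bounded id.
Proof. by exists 1 => n; rewrite expn1 leq_addr. Qed.

(** For [n >= 2] one has [n + 2 <= n ^ 2], so [n ^ (2 * a)] dominates; for [n < 2] the constant
    [3 ^ a] does. *)
Lemma poly_bounded_time f : poly_bounded f -> exists d, forall n, f n <= n ^ d + d.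
Proof.
move=> [a Ha]; exists (2 * a + 3 ^ a) => n; apply: leq_trans (Ha n) _.
have [le2|lt2] := leqP 2 n.
  apply: leq_trans (leq_addr _ _); apply: (@leq_trans (n ^ (2 * a))).
    by rewrite expnM; case: a {Ha} => // a; rewrite leq_exp2r //; nia.
  by rewrite leq_pexp2l ?leq_addr // ltnW.
apply: leq_trans (leq_addl _ _); apply: leq_trans (leq_addl _ _).
by case: a {Ha} => // a; rewrite leq_exp2r //; lia.
Qed.

(* [None] stands for [j] copies of [true], each in the encoding of [enc_word]. *)
Definition piece := option bool.
Definition expand1 (j : nat) (p : piece) : word :=
  if p is Some b then [:: b] else nseq j.*2 true.
Definition expand (j : nat) (ps : seq piece) : word :=
  flatten [seq expand1 j p | p <- ps].

Section Generator.
Variables (D : nat) (PA PB : seq piece) (PW : bool -> seq piece) (PE : seq piece).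

(** The four parts will be the axioms of each counter bit, those instantiated at the number of bits,
    those of each input letter, and the remainder of the instance. *)
Definition generated (w : word) : word :=
  flatten [seq expand j PA | j <- iota 0 ((size w + 2) ^ D)]
  ++ expand ((size w + 2) ^ D) PB
  ++ flatten [seq expand i (PW (nth false w i)) | i <- iota 0 (size w)]
  ++ expand (size w) PE.

(* Besides the input, two unary counters and the output there are [D] tapes
   holding [size w + 2] marks, the ranges of [D] nested loops. *)
Let k := D + 3.
Local Notation prog := (prog k).
Local Notation store := (store k).

Definition mark (b : bool) : sym := Some (inl b).
Definition inp : 'I_k.+1 := ord0.
Definition out : 'I_k.+1 := ord_max.
Definition ctrA : 'I_k.+1 := inord 1.
Definition ctrB : 'I_k.+1 := inord 2.
Definition lp e : 'I_k.+1 := inord (3 + e).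

Definition outT (o : word) : track := tp (rev (map mark o)) [::].
Definition ctrT (j : nat) : track := tp (nseq j (mark true)) [::].

Definition write i b : prog := op i (fun=> mark b) MoveRight.

(** Each mark of the counter [c] yields two bits, since [enc_word] writes a letter [true] as two.
    The copying loop undoes the rewinding: it leaves the head after the last mark, ready for the
    next increment. *)
Definition emit1 (c : 'I_k.+1) (p : piece) : prog :=
  if p is Some b then write out b else
  pseq (rewind c)
    (pwhile c (pseq (write out true) (pseq (write out true) (goright c)))).

Definition emit (c : 'I_k.+1) (ps : seq piece) : prog :=
  foldr (fun p A => pseq (emit1 c p) A) (skip k) ps.

Lemma runs_write (s : store) i b l : s i = tp l [::] ->
  runs (write i b) s 1 (upd s i (tp (mark b :: l) [::])).
Proof.
by move=> e; have := runs_op i (fun=> mark b) MoveRight s;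
  rewrite e put_tp shift_right.
Qed.

Lemma runs_write_out (s : store) o b : s out = outT o ->
  runs (write out b) s 1 (upd s out (outT (rcons o b))).
Proof. by move/runs_write=> r; rewrite /outT map_rcons rev_rcons; apply: r. Qed.

Lemma runs_emit1 c p (s : store) o j : c != out ->
  s out = outT o -> s c = ctrT j ->
  runs (emit1 c p) s (6 * j + 6) (upd s out (outT (o ++ expand1 j p))).
Proof.
move=> co so sc; case: p => [b|] /=.
  by rewrite cats1; apply: runs_le (runs_write_out _ so) _; lia.
have r1 := @runs_rewind _ s c _ _ sc.
have {r1} := r1 _; rewrite all_nseq orbT => /(_ isT).
rewrite cats0 size_nseq rev_nseq => r1.
pose St a := upd (upd s c (tp (nseq a (mark true)) (nseq (j - a) (mark true))))
  out (outT (o ++ nseq a.*2 true)).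
have oc : out != c by rewrite eq_sym.
have r2 : runs (pwhile c (pseq (write out true) (pseq (write out true) (goright c))))
   (St 0) (j * 4).+1 (St j).
  apply: runs_while => [a lt||a lt].
  - by rewrite /St upd_neq // updE head_tp; case: (j - a) (subn_gt0 a j) => [|m] //; rewrite lt.
  - by rewrite /St upd_neq // updE head_tp subnn.
  have e0 : St a out = outT (o ++ nseq a.*2 true) by rewrite /St updE.
  have s1 := runs_write_out true e0.
  have s2 := runs_write_out true (updE (St a) out (outT (rcons (o ++ nseq a.*2 true) true))).
  rewrite upd_upd in s2.
  set st := upd _ _ (outT (rcons (rcons _ _) _)) in s2.
  have e3 : st c = tp (nseq a (mark true)) (nseq (j - a) (mark true)).
    by rewrite /st /St upd_neq // upd_neq // updE.
  have s3 := runs_goright e3.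
  have := runs_le (runs_seq s1 (runs_seq s2 s3)) (leqnn 3).
  congr runs; apply/funext=> i; rewrite /st /St /upd.
  case: (i =P c) => [->|_]; rewrite ?(negPf co).
    by rewrite subnS; case: (j - a) (subn_gt0 a j) => [|m] //; rewrite lt.
  by case: (i =P out) => // _; rewrite -!cats1 -!catA doubleS -addn2 nseqD.
have e0 : St 0 = upd s c (tp [::] (nseq j (mark true))).
  by rewrite /St subn0 upd_id // upd_neq // cats0.
rewrite e0 in r2.
have -> : upd s out (outT (o ++ nseq j.*2 true)) = St j.
  by rewrite /St subnn (@upd_id _ _ c).
by apply: runs_le (runs_seq r1 r2) _; lia.
Qed.

Lemma runs_emit c ps (s : store) o j : c != out ->
  s out = outT o -> s c = ctrT j ->
  runs (emit c ps) s (size ps * (6 * j + 6)).+1 (upd s out (outT (o ++ expand j ps))).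
Proof.
move=> co; elim: ps s o => [|p ps IH] s o so sc /=.
  by rewrite cats0 upd_id //; apply: runs_skip.
have r1 := runs_emit1 p co so sc.
have := IH (upd s out (outT (o ++ expand1 j p))) _ (updE _ _ _).
rewrite upd_neq // sc upd_upd => /(_ erefl) r2.
rewrite -catA in r2.
by rewrite mulSn -addnS; apply: runs_seq r1 r2.
Qed.

Lemma all_mark w : all isSome (map mark w).
Proof. by rewrite all_map; apply/allP. Qed.

Lemma val_out : out = D + 3 :> nat. Proof. by []. Qed.
Lemma val_inp : inp = 0 :> nat. Proof. by []. Qed.
Lemma val_ctrA : ctrA = 1 :> nat. Proof. by rewrite /ctrA inordK // /k; lia. Qed.
Lemma val_ctrB : ctrB = 2 :> nat. Proof. by rewrite /ctrB inordK // /k; lia. Qed.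
Lemma val_lp e : e < D -> lp e = 3 + e :> nat.
Proof. by move=> lt; rewrite /lp inordK // /k; lia. Qed.

Definition val_tapes := (val_out, val_inp, val_ctrA, val_ctrB).

Lemma neq_val (i j : 'I_k.+1) : (i != j) = (i != j :> nat).
Proof. by []. Qed.

Lemma ctrA_out : ctrA != out. Proof. by rewrite neq_val !val_tapes; lia. Qed.
Lemma ctrB_out : ctrB != out. Proof. by rewrite neq_val !val_tapes; lia. Qed.
Lemma ctrA_ctrB : ctrA != ctrB. Proof. by rewrite neq_val !val_tapes. Qed.
Lemma ctrB_inp : ctrB != inp. Proof. by rewrite neq_val !val_tapes. Qed.
Lemma ctrA_inp : ctrA != inp. Proof. by rewrite neq_val !val_tapes. Qed.
Lemma out_inp : out != inp. Proof. by rewrite neq_val !val_tapes; lia. Qed.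

(** * Initialisation of the loop tapes *)

Fixpoint all_lp (f : 'I_k.+1 -> prog) n : prog :=
  if n is m.+1 then pseq (all_lp f m) (f (lp m)) else skip k.

Definition updl (s : store) n (g : track) : store :=
  fun i => if (2 < i) && (i < 3 + n) then g else s i.

Lemma runs_all_lp f g g' t n (s : store) :
  (forall (s : store) i, s i = g -> runs (f i) s t (upd s i g')) ->
  n <= D -> (forall e, e < n -> s (lp e) = g) ->
  runs (all_lp f n) s (n * t).+1 (updl s n g').
Proof.
move=> hf; elim: n => [|n IH] /= leD sg.
  rewrite (_ : updl _ _ _ = s); first exact: runs_skip.
  by apply/funext=> i; rewrite /updl addn0; case: ifP => //; lia.
have r1 : runs (all_lp f n) s (n * t).+1 (updl s n g').
  by apply: IH => [|e lt]; [exact: ltnW | apply: sg; apply: ltnW].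
have eg : updl s n g' (lp n) = g.
  by rewrite /updl val_lp // ltnn andbF sg.
have := runs_seq r1 (hf _ _ eg).
rewrite (_ : upd _ _ _ = updl s n.+1 g').
  by move/runs_le; apply; lia.
apply/funext=> i; rewrite /upd /updl -val_eqE /= val_lp //.
by case: eqP => [->|ne]; [rewrite ifT //; lia | congr (if _ then _ else _); lia].
Qed.

Definition base (f : track) : store := fun i => if i == inp then f else tp [::] [::].

Lemma updl_updl s n g g' : updl (updl s n g) n g' = updl s n g'.
Proof. by apply/funext=> i; rewrite /updl; case: (_ && _). Qed.

Lemma updl_lp s n g e : e < n -> n <= D -> updl s n g (lp e) = g.
Proof. by move=> lt le; rewrite /updl val_lp ?ifT //; lia. Qed.

Lemma updl_out s n g (i : 'I_k.+1) : (i < 3) || (3 + n <= i) -> updl s n g i = s i.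
Proof. by rewrite /updl; case: ifP => //; lia. Qed.

Lemma upd_base s f f' n : upd (updl (base f) n s) inp f' = updl (base f') n s.
Proof.
apply/funext=> i; rewrite /upd /updl /base; case: eqP => // ->.
by rewrite val_inp.
Qed.

(** Every loop tape receives one mark per input letter and then two more; all heads are brought back
    to the start. *)
Definition prep : prog :=
  pseq (pwhile inp (pseq (all_lp (write^~ true) D) (goright inp)))
  (pseq (all_lp (write^~ true) D) (pseq (all_lp (write^~ true) D)
  (pseq (all_lp (@rewind k) D) (rewind inp)))).

Definition prep_time (n : nat) : nat :=
  (n * ((D * 1).+1 + 1).+1).+1 + ((D * 1).+1 + ((D * 1).+1 +
   ((D * (2 * (n + 2) + 3)).+1 + (2 * n + 3)))).

Definition input (w : word) : track := tp [::] (map mark w).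
Definition loopT (n : nat) : track := tp [::] (nseq n (mark true)).

Lemma runs_prep w : runs prep (base (input w)) (prep_time (size w))
  (updl (base (input w)) D (loopT (size w + 2))).
Proof.
set u := map mark w; have su : size u = size w by rewrite size_map.
pose St a := updl (base (tp (rev (take a u)) (drop a u))) D (ctrT a).
have wr (s : store) a : (forall e, e < D -> s (lp e) = ctrT a) ->
    runs (all_lp (write^~ true) D) s (D * 1).+1 (updl s D (ctrT a.+1)).
  by move=> h; apply: runs_all_lp h => // s' i; apply: runs_write.
have r1 : runs (pwhile inp (pseq (all_lp (write^~ true) D) (goright inp)))
    (St 0) (size w * ((D * 1).+1 + 1).+1).+1 (St (size w)).
  apply: (@runs_while _ _ _ St) => [a lt||a lt].
  - rewrite /St updl_out // /base eqxx head_tp -nth0 nth_drop addn0.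
    by move/(all_nthP None): (all_mark w); apply; rewrite -/u su.
  - by rewrite /St updl_out // /base eqxx head_tp drop_oversize ?su.
  have := wr (St a) a; rewrite /St updl_updl => /(_ _) r.
  have {}r := r (fun e lte => updl_lp _ _ lte (leqnn D)).
  set st := updl _ _ (ctrT a.+1) in r.
  have e2 : st inp = tp (rev (take a u)) (drop a u).
    by rewrite /st updl_out // /base eqxx.
  have := runs_seq r (runs_goright e2).
  rewrite /st upd_base -[head _ _]nth0 nth_drop addn0 -drop1 drop_drop add1n.
  by rewrite (take_nth None) ?su // rev_rcons.
have e0 : base (input w) = St 0.
  rewrite /St take0 drop0; apply/funext=> i; rewrite /updl /base.
  by case: (i =P inp) => [->|_]; [rewrite val_inp | case: ifP].
rewrite {1}e0; apply: runs_seq r1 _.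
rewrite /St take_oversize ?su // drop_oversize ?su //.
set b := base _.
have r2 := wr (updl b D (ctrT (size w))) (size w)
  (fun e lte => updl_lp _ _ lte (leqnn D)).
rewrite updl_updl in r2; apply: runs_seq r2 _.
have r3 := wr (updl b D (ctrT (size w).+1)) (size w).+1
  (fun e lte => updl_lp _ _ lte (leqnn D)).
rewrite updl_updl in r3; apply: runs_seq r3 _.
have r4 : runs (all_lp (@rewind k) D) (updl b D (ctrT (size w).+2))
   (D * (2 * (size w + 2) + 3)).+1 (updl b D (loopT (size w + 2))).
  rewrite -(updl_updl b D (ctrT (size w).+2) (loopT _)).
  apply: (@runs_all_lp _ (ctrT (size w).+2)) => // [s i si|e lte].
    have := runs_rewind si; rewrite all_nseq orbT => /(_ isT).
    by rewrite size_nseq cats0 rev_nseq addn2.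
  by rewrite updl_lp.
apply: runs_seq r4 _.
have e5 : updl b D (loopT (size w + 2)) inp = tp (rev u) [::].
  by rewrite updl_out // /b /base eqxx.
have := runs_rewind e5; rewrite revK cats0 size_rev su upd_base; apply.
by rewrite all_rev all_mark.
Qed.

(** The innermost body instantiates the template at the value of [ctrA] and increments it. Each loop
    rewinds its tape at the end, so that the enclosing loop can start it again. *)
Fixpoint nest e : prog :=
  if e is e'.+1 then
    pseq (pwhile (lp e') (pseq (nest e') (goright (lp e')))) (rewind (lp e'))
  else pseq (emit ctrA PA) (write ctrA true).

Fixpoint nest_time (n e : nat) : nat :=
  if e is e'.+1 then ((n + 2) * (nest_time n e' + 1).+1).+1 + (2 * (n + 2) + 3)
  else (size PA * (6 * (n + 2) ^ D + 6)).+1 + 1.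

(** The counter value and the output are general for the induction on [e]. The last hypothesis keeps
    the counter at most [(n + 2) ^ D], so that one time bound serves all emissions. *)
Lemma runs_nest n e (s : store) a o : e <= D ->
  (forall e', e' < e -> s (lp e') = loopT (n + 2)) ->
  s ctrA = ctrT a -> s out = outT o -> a + (n + 2) ^ e <= (n + 2) ^ D ->
  runs (nest e) s (nest_time n e)
    (upd (upd s ctrA (ctrT (a + (n + 2) ^ e))) out
      (outT (o ++ flatten [seq expand j PA | j <- iota a ((n + 2) ^ e)]))).
Proof.
elim: e s a o => [|e IH] s a o leD sl sc so lea.
  rewrite expn0 (addn1 a) /= cats0.
  have r1 := runs_emit PA ctrA_out so sc.
  have e2 : upd s out (outT (o ++ expand a PA)) ctrA = ctrT a.
    by rewrite upd_neq // ctrA_out.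
  have := runs_seq r1 (runs_write true e2).
  rewrite upd_comm 1?eq_sym ?ctrA_out // => /runs_le; apply.
  by rewrite leq_add2r ltnS leq_mul2l leq_add2r leq_mul2l; rewrite expn0 in lea; lia.
set N := n + 2 in sl lea *.
have val_e := val_lp leD.
have lpA : lp e != ctrA by rewrite neq_val val_e val_tapes.
have lpO : lp e != out by rewrite neq_val val_e val_tapes; lia.
(* After [b] rounds of loop [e] the counter has advanced by [b * N ^ e]. *)
pose St b := upd (upd (upd s (lp e) (tp (nseq b (mark true)) (nseq (N - b) (mark true))))
  ctrA (ctrT (a + b * N ^ e))) out
  (outT (o ++ flatten [seq expand j PA | j <- iota a (b * N ^ e)])).
have StL b : St b (lp e) = tp (nseq b (mark true)) (nseq (N - b) (mark true)).
  by rewrite /St 2?upd_neq // updE.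
have r1 : runs (pwhile (lp e) (pseq (nest e) (goright (lp e)))) (St 0)
    (N * (nest_time n e + 1).+1).+1 (St N).
  apply: (@runs_while _ _ _ St) => [b ltb||b ltb].
  - by rewrite StL head_tp; case: (N - b) (subn_gt0 b N) => [|m] //; rewrite ltb.
  - by rewrite StL head_tp subnn.
  have lb : a + b * N ^ e + N ^ e <= N ^ D.
    apply: leq_trans lea; rewrite expnS; nia.
  have := @IH (St b) (a + b * N ^ e) _ (ltnW leD) _ _ (updE _ _ _) lb.
  have h1 e' : e' < e -> St b (lp e') = loopT N.
    move=> lte; rewrite /St !upd_neq ?sl // ?neq_val ?val_lp ?val_tapes //; lia.
  have h2 : St b ctrA = ctrT (a + b * N ^ e) by rewrite /St upd_neq ?updE ?ctrA_out.
  move=> /(_ h1 h2); set st := upd _ out _ => r.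
  have e3 : st (lp e) = tp (nseq b (mark true)) (nseq (N - b) (mark true)).
    by rewrite /st 2?upd_neq // StL.
  have := runs_seq r (runs_goright e3); congr runs.
  apply/funext=> i; rewrite /st /St /upd.
  case: (i =P lp e) => [->|_].
    rewrite (negPf lpO) (negPf lpA).
    by rewrite subnS; case: (N - b) (subn_gt0 b N) => [|m] //; rewrite ltb.
  case: (i =P out) => _.
    by rewrite -catA -flatten_cat -map_cat -iotaD mulSn addnC.
  by case: (i =P ctrA) => // _; rewrite mulSn -addnA (addnC (N ^ e)).
have e0 : St 0 = s.
  rewrite /St subn0 mul0n addn0 /= cats0 !upd_id //.
  all: try by rewrite ?upd_neq ?sl // eq_sym // ctrA_out.
rewrite e0 in r1.
have := runs_rewind (StL N); rewrite subnn all_nseq orbT => /(_ isT).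
rewrite size_nseq cats0 rev_nseq => r2.
have := runs_seq r1 r2; congr runs; apply/funext=> i; rewrite /St /upd -expnS.
case: (i =P lp e) => // ->; rewrite (negPf lpO) (negPf lpA).
by rewrite sl.
Qed.

Definition scan : prog :=
  pwhile inp (pseq (pif inp (pred1 (mark true))
                     (emit ctrB (PW true)) (emit ctrB (PW false)))
             (pseq (write ctrB true) (goright inp))).

Definition scan_time n :=
  (n * ((maxn (size (PW true)) (size (PW false)) * (6 * n + 6)).+2 + 2).+1).+1.

Lemma runs_scan w (s : store) o :
  s inp = input w -> s ctrB = ctrT 0 -> s out = outT o ->
  exists f, runs scan s (scan_time (size w))
    (upd (upd (upd s inp f) ctrB (ctrT (size w))) out
     (outT (o ++ flatten [seq expand i (PW (nth false w i)) | i <- iota 0 (size w)]))).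
Proof.
move=> si sc so; set u := map mark w; have su : size u = size w by rewrite size_map.
pose St a := upd (upd (upd s inp (tp (rev (take a u)) (drop a u))) ctrB (ctrT a)) out
  (outT (o ++ flatten [seq expand i (PW (nth false w i)) | i <- iota 0 a])).
exists (tp (rev (take (size w) u)) (drop (size w) u)).
have e0 : St 0 = s.
  rewrite /St take0 drop0 /= cats0 !upd_id //.
  all: try by rewrite ?upd_neq ?si ?sc ?so // eq_sym ?ctrB_inp ?out_inp ?ctrB_out.
have inpO : inp != out by rewrite eq_sym out_inp.
have inpB : inp != ctrB by rewrite eq_sym ctrB_inp.
have StI a : St a inp = tp (rev (take a u)) (drop a u).
  by rewrite /St 2?upd_neq // updE.
have hd a : a < size w -> St a inp 0%R = mark (nth false w a).
  move=> lt; rewrite StI head_tp -nth0 nth_drop addn0.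
  by rewrite (nth_map false).
rewrite -{1}e0; apply: (@runs_while _ _ _ St) => [a lt||a lt].
- by rewrite hd.
- by rewrite StI head_tp drop_oversize ?su.
have StB : St a ctrB = ctrT a by rewrite /St upd_neq ?updE ?ctrB_out.
have r0 b := runs_emit (PW b) ctrB_out (updE _ _ _ : St a out = _) StB.
have r1 : runs (pif inp (pred1 (mark true)) (emit ctrB (PW true)) (emit ctrB (PW false)))
   (St a) (maxn (size (PW true)) (size (PW false)) * (6 * size w + 6)).+2
   (upd (St a) out (outT (o ++ flatten [seq expand i (PW (nth false w i)) | i <- iota 0 a.+1]))).
  rewrite -(addn1 a) iotaD map_cat flatten_cat /= cats0 add0n catA.
  apply: runs_if; rewrite hd //=.
  have := r0 (nth false w a).
  by case: (nth false w a) => /runs_le; apply; rewrite ltnS leq_mul // ?leq_maxl ?leq_maxr //; lia.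
set st := upd _ _ _ in r1.
have e2 : st ctrB = ctrT a by rewrite /st upd_neq ?StB ?ctrB_out.
have r2 := runs_write true e2.
set st2 := upd st _ _ in r2.
have e3 : st2 inp = tp (rev (take a u)) (drop a u).
  by rewrite /st2 upd_neq // /st upd_neq ?StI.
have := runs_seq r1 (runs_seq r2 (runs_goright e3)); congr runs.
apply/funext=> i; rewrite /st2 /st /St /upd.
case: (i =P inp) => [->|_].
  rewrite (negPf inpO) (negPf inpB).
  rewrite -[head _ _]nth0 nth_drop addn0 -drop1 drop_drop add1n.
  by rewrite (take_nth None) ?su // rev_rcons.
case: (i =P ctrB) => [->|_]; first by rewrite (negPf ctrB_out).
by case: (i =P out).
Qed.

(** After the nested loops [ctrA] holds [(size w + 2) ^ D], and after the scan [ctrB] holds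
    [size w]: the indices at which [PB] and [PE] are instantiated. The last rewinding puts the head
    where [output] starts to read. *)
Definition generator : prog :=
  pseq prep (pseq (nest D) (pseq (emit ctrA PB) (pseq scan
    (pseq (emit ctrB PE) (rewind out))))).

Definition generator_time (n o : nat) : nat :=
  prep_time n + (nest_time n D + ((size PB * (6 * (n + 2) ^ D + 6)).+1 +
    (scan_time n + ((size PE * (6 * n + 6)).+1 + (2 * o + 3))))).

Lemma runs_generator w : exists2 s,
  runs generator (base (input w)) (generator_time (size w) (size (generated w))) s &
  s out = tp [::] (map mark (generated w)).
Proof.
set K := (size w + 2) ^ D.
set s1 := updl (base (input w)) D (loopT (size w + 2)).
have inp_out : inp != out by rewrite eq_sym out_inp.
have s1A : s1 ctrA = ctrT 0.
  by rewrite /s1 updl_out /base ?(negPf ctrA_inp) // val_ctrA.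
have s1B : s1 ctrB = ctrT 0.
  by rewrite /s1 updl_out /base ?(negPf ctrB_inp) // val_ctrB.
have s1O : s1 out = outT [::].
  by rewrite /s1 updl_out /base ?(negPf out_inp) // val_out addnC leqnn orbT.
have s1L e : e < D -> s1 (lp e) = loopT (size w + 2) by move=> lt; rewrite /s1 updl_lp.
have r2 := runs_nest (leqnn D) s1L s1A s1O (leqnn K).
rewrite !add0n /= -/K in r2; set o1 := flatten _ in r2.
set s2 := upd _ _ _ in r2.
have s2A : s2 ctrA = ctrT K by rewrite /s2 upd_neq ?updE // ctrA_out.
have s2O : s2 out = outT o1 by rewrite /s2 updE.
have r3 := runs_emit PB ctrA_out s2O s2A.
set s3 := upd _ _ _ in r3.
have s3O : s3 out = outT (o1 ++ expand K PB) by rewrite /s3 updE.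
have s3B : s3 ctrB = ctrT 0.
  by rewrite /s3 /s2 !upd_neq ?ctrB_out // eq_sym ctrA_ctrB.
have s3I : s3 inp = input w.
  by rewrite /s3 /s2 !upd_neq // 1?eq_sym ?ctrA_inp // /s1 updl_out // /base eqxx.
have [f r4] := runs_scan s3I s3B s3O.
set s4 := upd _ out _ in r4; set o3 := (X in outT X) in s4 r4.
have s4B : s4 ctrB = ctrT (size w) by rewrite /s4 upd_neq ?updE // ctrB_out.
have r5 := runs_emit PE ctrB_out (updE _ _ _ : s4 out = outT o3) s4B.
set s5 := upd _ _ _ in r5.
have eg : o3 ++ expand (size w) PE = generated w by rewrite /o3 /generated -!catA.
have s5O : s5 out = outT (generated w) by rewrite /s5 updE eg.
have := runs_rewind s5O; rewrite all_rev all_mark size_rev size_map revK cats0.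
move=> /(_ isT) r6; eexists; last exact: updE.
apply: runs_seq (runs_prep w) (runs_seq r2 (runs_seq r3 (runs_seq r4 _))).
exact: runs_seq r5 r6.
Qed.

(** * Polynomial bounds on the output and on the running time *)

Lemma size_expand j ps : size (expand j ps) <= size ps * (2 * j + 1).
Proof.
elim: ps => // p ps IH; rewrite /expand /= size_cat mulSn leq_add //.
by case: p => [b|] /=; rewrite ?size_nseq; lia.
Qed.

Definition generated_size (n : nat) : nat :=
  (n + 2) ^ D * (size PA * (2 * (n + 2) ^ D + 1))
  + (size PB * (2 * (n + 2) ^ D + 1)
  + (n * (maxn (size (PW true)) (size (PW false)) * (2 * n + 1))
  + size PE * (2 * n + 1))).

Lemma size_flatten_iota (f : nat -> word) a m :
  (forall j, j < a -> size (f j) <= m) ->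
  size (flatten [seq f j | j <- iota 0 a]) <= a * m.
Proof.
elim: a => // a IH h; rewrite -(addn1 a) iotaD map_cat flatten_cat /= cats0.
rewrite size_cat mulnDl mul1n leq_add ?h ?add0n ?addn1 //.
by apply: IH => j lt; apply: h; apply: ltnW.
Qed.

Lemma size_generated w : size (generated w) <= generated_size (size w).
Proof.
rewrite /generated !size_cat !leq_add ?size_expand //.
  apply: size_flatten_iota => j lt; apply: leq_trans (size_expand _ _) _.
  by apply: leq_mul => //; lia.
apply: size_flatten_iota => j lt; apply: leq_trans (size_expand _ _) _.
apply: leq_mul; last lia.
by case: (nth false w j); rewrite ?leq_maxl ?leq_maxr.
Qed.

Lemma nest_time_poly e : poly_bounded (nest_time^~ e).
Proof.
elim: e => [|e IH] /=;
  do ?[exact: IH | apply: poly_bounded_succ | apply: poly_bounded_add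
      | apply: poly_bounded_mul | exact: poly_bounded_id
      | exact: poly_bounded_exp | exact: poly_bounded_const].
Qed.

Lemma generator_time_poly : poly_bounded (fun n => generator_time n (generated_size n)).
Proof.
rewrite /generator_time /prep_time /scan_time /generated_size.
do ?[exact: nest_time_poly | apply: poly_bounded_succ | apply: poly_bounded_add
      | apply: poly_bounded_mul | exact: poly_bounded_id
      | exact: poly_bounded_exp | exact: poly_bounded_const].
Qed.

Lemma polytime_generated : polytime_computable generated.
Proof.
have [d hd] := poly_bounded_time generator_time_poly.
exists k, (tm_of generator), d => w.
have [s r so] := runs_generator w.
have {}r := runs_le r (leq_trans _ (hd (size w))).
have {r}[] := @runs_from_tm _ _ _ _ _ _ (init (tm_of generator) w) (r _) erefl _.
- rewrite /generator_time; do 5![apply: leq_add => //].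
  by rewrite leq_add2r leq_mul2l size_generated orbT.
- move=> i; rewrite /base /= /inp; case: eqP => _ /=.
    rewrite /input_tape /track_of /input /=.
    by case: (w) => [|b w'] //=; apply: (tp_blank_right _ [::]).
  exact: (tp_blank_right _ [::]).
set c := iter _ _ _ => halt_c eq_c; exists c; first by [].
rewrite /output; have := eq_c ord_max; rewrite so; clear.
case: (config_tapes c ord_max) => l a r /= e.
have {}e i : nth None (a :: r) i = nth None (map mark (generated w)) i.
  exact: (congr1 (fun f : track => f (Posz i)) e).
rewrite -[(if _ then _ else _)]/(index (blank (tm_of generator)) (a :: r)).
move: (a :: r) e => t; elim: (generated w) t => [|b o IH] [|x t] e //=.
- by have := e 0 => /= ->.
- by have := e 0.
by have := e 0 => /= ->; rewrite /= IH // => i; apply: (e i.+1).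
Qed.
End Generator.

(** * Counters *)

Definition dec_mod (K x : nat) : nat := if x == 0 then (2 ^ K).-1 else x.-1.
Definition inc_mod (K x : nat) : nat := if x.+1 == 2 ^ K then 0 else x.+1.

Lemma dec_modK K x y : y < 2 ^ K -> dec_mod K y = x -> inc_mod K x = y.
Proof.
rewrite /dec_mod /inc_mod => lt <-; case: (y =P 0) => [e|ne].
  by rewrite e ifT //; lia.
by rewrite ifF; lia.
Qed.

Fixpoint bits_val (K : nat) (b : nat -> bool) : nat :=
  if K is K'.+1 then bits_val K' b + b K' * 2 ^ K' else 0.

Lemma bits_val_lt K b : bits_val K b < 2 ^ K.
Proof. by elim: K => //= K IH; rewrite expnS; case: (b K); lia. Qed.

Lemma bits_val_ext K b b' : (forall j, j < K -> b j = b' j) -> bits_val K b = bits_val K b'.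
Proof.
elim: K => //= K IH e; rewrite e // IH // => j lt; apply: e; exact: ltnW.
Qed.

Lemma bits_val_eq0 K b : (bits_val K.+1 b == 0) = (bits_val K b == 0) && ~~ b K.
Proof. by rewrite /= addn_eq0 muln_eq0 eqb0 expn_eq0 /= orbF. Qed.

(** A borrow reaches bit [j] exactly when all lower bits are zero; at value zero it flips every bit,
    which is the wrap-around. *)
Lemma bits_val_dec K b b' :
  (forall j, j < K -> b' j = b j (+) (bits_val j b == 0)) ->
  bits_val K b' = dec_mod K (bits_val K b).
Proof.
elim: K => //= K IH h; rewrite {}IH => [|j lt]; last by apply: h; apply: ltnW.
rewrite h // /dec_mod; have lt := bits_val_lt K b.
by case: (b K) => /=; case: (bits_val K b =P 0) => e0 /=; case: eqP; rewrite ?expnS; lia.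
Qed.

Lemma bits_val_top K (b : nat -> bool) : b K -> 2 ^ K <= bits_val K.+1 b.
Proof. by move=> /= ->; rewrite mul1n leq_addl. Qed.

(** On an explicit list this computes to a conjunction, which intro patterns can take apart axiom by
    axiom. *)
Fixpoint Alls (T : Type) (P : T -> Prop) (s : seq T) : Prop :=
  if s is x :: s' then P x /\ Alls P s' else True.

Lemma Alls_cat T (P : T -> Prop) s1 s2 : Alls P (s1 ++ s2) <-> Alls P s1 /\ Alls P s2.
Proof. by elim: s1 => [|x s1 IH] /=; tauto. Qed.

Lemma Alls_map T T' (f : T' -> T) (P : T -> Prop) s : Alls P (map f s) <-> Alls (P \o f) s.
Proof. by elim: s => [|x s IH] //=; tauto. Qed.

Lemma Alls_flatten T (P : T -> Prop) ss : Alls P (flatten ss) <-> Alls (Alls P) ss.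
Proof. by elim: ss => [|s ss IH] //=; rewrite Alls_cat; tauto. Qed.

Lemma Alls_mem (T : eqType) (P : T -> Prop) s : Alls P s <-> forall x, x \in s -> P x.
Proof.
elim: s => [|x s IH] //=; rewrite IH; split=> [[Px Ps] y|h].
  by rewrite inE => /predU1P[->|/Ps].
by split=> [|y ys]; apply: h; rewrite inE ?eqxx ?ys ?orbT.
Qed.

Lemma Alls_imp T (P Q : T -> Prop) s : (forall x, P x -> Q x) -> Alls P s -> Alls Q s.
Proof. by move=> h; elim: s => //= x s IH [/h ? /IH]. Qed.

(** * The knowledge base *)

Section Reduction.
(* [verdict] is the value of [accepting] for which a model is to exist. *)
Variables (M : tm 0) (c : numeral) (verdict : bool).

Local Notation cell := (symbol M).

(* The Boolean argument of [KV], [KZ], ... selects the counter: [time] or [pos]. *)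
Definition time := true.
Definition pos := false.

(* [KU] and [KF b] are the choice concept and the names of its two elements; bit
   [j] of a counter is [b] when there is a [KV]-successor of index [j.+1] in
   [KF b]. [KZero] and [KPos] mean that the counter is zero or positive, [KLate]
   that the top bit of [time] is set. [KI] of index [i] labels at time 0 the
   cell [i], or all cells from [i] on if [i] is the length of the input; [KQ] is
   the state, [KS] the symbol in the cell, [KG] the state and the scanned symbol. *)
Inductive kind :=
| KU | KF of bool | KV of bool | KZ of bool | KN of bool | KZero of bool
| KPos of bool | KLate | KI | KQ of state M | KS of cell | KG of state M & cell
| KKey of nat & nat | KAnswer | KP | KD | KE.

(* The code is kept behind [Qed]: names containing it must never be computed. *)
Lemma kind_code_exists : exists f : kind -> nat, injective f.
Proof.
exists (fun x => pickle (match x with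
  | KU => (0, false, None, None, (0, 0))
  | KF b => (1, b, None, None, (0, 0))
  | KV b => (2, b, None, None, (0, 0))
  | KZ b => (3, b, None, None, (0, 0))
  | KN b => (4, b, None, None, (0, 0))
  | KZero b => (5, b, None, None, (0, 0))
  | KPos b => (6, b, None, None, (0, 0))
  | KLate => (7, false, None, None, (0, 0))
  | KI => (8, false, None, None, (0, 0))
  | KQ q => (9, false, Some q, None, (0, 0))
  | KS a => (10, false, None, Some a, (0, 0))
  | KG q a => (11, false, Some q, Some a, (0, 0))
  | KKey b r => (12, false, None, None, (b, r))
  | KAnswer => (13, false, None, None, (0, 0))
  | KP => (14, false, None, None, (0, 0))
  | KD => (15, false, None, None, (0, 0))
  | KE => (16, false, None, None, (0, 0))
  end : nat * bool * option (state M) * option cell * (nat * nat))).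
move=> x y /(pcan_inj (@pickleK _)).
by case: x => [|?|?|?|?|?|?|||?|?|? ?|? ?||||]; case: y => [|?|?|?|?|?|?|||?|?|? ?|? ?||||] // [] *;
  subst.
Qed.

Definition kind_code : kind -> nat := projT1 (cid kind_code_exists).

Lemma kind_code_inj : injective kind_code.
Proof. exact: projT2 (cid kind_code_exists). Qed.

(** The number of [false] gives the kind and the length of the tail gives the index. The index comes
    last and in unary, so that adding [j] to it means appending [j] times [true]. *)
Definition nm (x : kind) (j : nat) : word :=
  nseq (kind_code x) false ++ true :: nseq j true.

Lemma nm_inj x j y i : nm x j = nm y i -> x = y /\ j = i.
Proof.
move=> e; have : count (pred1 false) (nm x j) = count (pred1 false) (nm y i) by rewrite e.
rewrite /nm !count_cat /= !count_nseq !mul1n !mul0n !addn0 => /kind_code_inj exy.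
split=> //; move: (congr1 size e); rewrite /nm !size_cat /= !size_nseq exy; lia.
Qed.

Lemma nm_cat x o j : nm x o ++ nseq j true = nm x (o + j).
Proof. by rewrite /nm nseqD -catA. Qed.

Local Opaque nm.

(* In a template the first bit of a name tells whether the name is indexed;
   instantiation adds [j] to the index of the indexed names. *)
Definition var x o : word := true :: nm x o.
Definition cst x o : word := false :: nm x o.

Definition inst_name (j : nat) (x : word) : word :=
  match x with
  | true :: y => y ++ nseq j true
  | _ => behead x
  end.

Fixpoint inst (j : nat) (C : concept) : concept :=
  match C with
  | CName A => CName (inst_name j A)
  | CTop => CTop
  | CBot => CBot
  | CAnd C D => CAnd (inst j C) (inst j D)
  | CEx R C => CEx (inst_name j R) (inst j C)
  end.

Definition axiom := (inclusion * weight)%type.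

Definition inst_axiom (j : nat) (x : axiom) : axiom :=
  ((inst j x.1.1, inst j x.1.2), x.2).

(* The second conjunct occurs nowhere else: it only makes the axioms distinct. *)
Definition add_key (b r : nat) (x : axiom) : axiom :=
  ((x.1.1, CAnd x.1.2 (CName (var (KKey b r) 0))), x.2).

(** The key records the block [b] and the rank in the block; instantiation adds the index of the
    copy. *)
Definition keyed (b : nat) (l : seq axiom) : seq axiom :=
  [seq add_key b rx.1 rx.2 | rx <- zip (iota 0 (size l)) l].

(** * Encodings of templates as pieces *)

Definition lit (w : word) : seq piece := map Some w.

(** In an indexed name the closing [false] of the encoded list must follow the appended copies of
    [true], hence the final two pieces. *)
Definition name_pieces (x : word) : seq piece :=
  match x with
  | true :: y => lit (flatten [seq [:: true; b] | b <- y]) ++ [:: None; Some false]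
  | _ => lit (enc_word (behead x))
  end.

Fixpoint concept_pieces (C : concept) : seq piece :=
  match C with
  | CName A => lit (enc_unary 0) ++ name_pieces A
  | CTop => lit (enc_unary 1)
  | CBot => lit (enc_unary 2)
  | CAnd C D => lit (enc_unary 3) ++ concept_pieces C ++ concept_pieces D
  | CEx R C => lit (enc_unary 4) ++ name_pieces R ++ concept_pieces C
  end.

Definition axiom_pieces (x : axiom) : seq piece :=
  Some true :: (concept_pieces x.1.1 ++ concept_pieces x.1.2) ++ lit (enc_weight c x.2).

Definition block_pieces (l : seq axiom) : seq piece := flatten (map axiom_pieces l).

Definition enc_axiom : axiom -> word :=
  enc_pair (enc_pair enc_concept enc_concept) (enc_weight c).

Definition enc_block (l : seq axiom) : word :=
  flatten [seq true :: enc_axiom x | x <- l].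

Lemma expand_cat j p q : expand j (p ++ q) = expand j p ++ expand j q.
Proof. by rewrite /expand map_cat flatten_cat. Qed.

Lemma expand_lit j w : expand j (lit w) = w.
Proof. by elim: w => //= b w; rewrite /expand /= => ->. Qed.

Lemma enc_wordE w : enc_word w = flatten [seq [:: true; b] | b <- w] ++ [:: false].
Proof. by elim: w => //= b w; rewrite /enc_word /= => ->. Qed.

Lemma expand_name j x : expand j (name_pieces x) = enc_word (inst_name j x).
Proof.
case: x => [|[] x]; rewrite ?expand_lit //= expand_cat expand_lit !enc_wordE.
rewrite map_cat flatten_cat -catA; congr (_ ++ _).
rewrite /expand /=; congr (_ ++ _).
by elim: j => //= j ->.
Qed.

Lemma expand_concept j C : expand j (concept_pieces C) = enc_concept (inst j C).
Proof.
by elim: C => [A|||C IHC C' IHD|R C IHC] //; rewrite /concept_pieces -/concept_pieces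
  ?expand_cat ?expand_lit ?expand_name ?IHC ?IHD.
Qed.

Lemma expand_block j l : expand j (block_pieces l) = enc_block (map (inst_axiom j) l).
Proof.
elim: l => //= x l IH; rewrite /block_pieces /= -/(block_pieces l).
rewrite -[Some true :: _]/(lit [:: true] ++ _) !expand_cat !expand_lit IH /=.
by rewrite !expand_concept.
Qed.

(** * Axioms for counters, input and transitions *)

Definition concept_name_of x := CName (cst x 0).
Local Notation cn := concept_name_of.
Definition ex_role x C := CEx (cst x 0) C.

Definition ax (C D : concept) : axiom := ((C, D), Inf).
(** The offset 1 lets the top block, instantiated at [K], refer to the top bit [K.-1] with offset
    0. *)
Definition tbit k b := CEx (var (KV k) 1) (cn (KF b)).
Definition tz k o := CName (var (KZ k) o).
Definition tn k o := CName (var (KN k) o).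

(* [Z_j] says that the bits below [j] are zero, [N_j] that one of them is not.
   Decrementing flips bit [j] exactly on [Z_j]. *)
Definition dec_axioms R k b : seq axiom :=
  [:: ax (CAnd (CAnd (tz k 0) (tbit k b)) (ex_role R (tbit k b))) CBot;
      ax (CAnd (CAnd (tn k 0) (tbit k b)) (ex_role R (tbit k (~~ b)))) CBot].

(** The decrement read backwards: the source of the role is to be the decrement of its target, so
    the zero tests are made at the target. *)
Definition inc_axioms R k b : seq axiom :=
  [:: ax (CAnd (tbit k b) (ex_role R (CAnd (tz k 0) (tbit k b)))) CBot;
      ax (CAnd (tbit k (~~ b)) (ex_role R (CAnd (tn k 0) (tbit k b)))) CBot].

Definition same_axioms R k b : seq axiom :=
  [:: ax (CAnd (tbit k b) (ex_role R (tbit k (~~ b)))) CBot].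

Definition counter_axioms k : seq axiom :=
  [:: ax CTop (CEx (var (KV k) 1) (cn KU));
      ax (CAnd (tbit k true) (tbit k false)) CBot;
      ax (CAnd (tz k 0) (tbit k false)) (tz k 1);
      ax (tn k 0) (tn k 1);
      ax (tbit k true) (tn k 1)].

Definition role_axioms b : seq axiom :=
  dec_axioms KP time b ++ same_axioms KP pos b ++
  dec_axioms KD pos b ++ same_axioms KD time b ++
  inc_axioms KE pos b ++ same_axioms KE time b.

Definition bit_block : seq axiom :=
  counter_axioms time ++ counter_axioms pos ++ role_axioms true ++ role_axioms false.

(** Instantiated at [K], where [Z] and [N] speak of all bits. The last axiom makes the individual
    asserted in [KF true] late, so that every model has a late element. *)
Definition top_block : seq axiom :=
  [:: ax (tz time 0) (cn (KZero time)); ax (tn time 0) (cn (KPos time));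
      ax (tz pos 0) (cn (KZero pos)); ax (tn pos 0) (cn (KPos pos));
      ax (CEx (var (KV time) 0) (cn (KF true))) (cn KLate);
      ax (cn (KF true)) (CEx (var (KV time) 0) (cn (KF true)))].

Definition input_block (b : bool) : seq axiom :=
  [:: ax (CName (var KI 0)) (cn (KS (bit M b)));
      ax (CAnd (cn (KPos pos)) (ex_role KD (CName (var KI 0)))) (CName (var KI 1))].

(** A halting pair is made stationary, so that the run continues to all times. *)
Definition transition (q : state M) (a : cell) : state M * cell * move :=
  if delta q [ffun=> a] is Some (q', f) then (q', (f ord0).1, (f ord0).2)
  else (q, a, Stay).

Definition look (m : move) (C : concept) : concept :=
  match m with
  | MoveLeft => ex_role KD C
  | Stay => C
  | MoveRight => ex_role KE C
  end.

(** State and scanned symbol are combined at position 0 and carried up to every position of the same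
    instant. The next instant takes its state from them, the written symbol where the old position
    was 0, and the old symbol elsewhere; as positions are relative to the head, [look] finds the old
    position from the move. For the wanted verdict the excluding axiom is made trivial. *)
Definition transition_axioms (qa : state M * cell) : seq axiom :=
  let: (q, a) := qa in
  let: (q', a', m) := transition q a in
  [:: ax (CAnd (cn (KZero pos)) (CAnd (cn (KQ q)) (cn (KS a)))) (cn (KG q a));
      ax (CAnd (cn (KPos pos)) (ex_role KD (cn (KG q a)))) (cn (KG q a));
      ax (ex_role KP (cn (KG q a))) (cn (KQ q'));
      ax (ex_role KP (CAnd (cn (KG q a)) (look m (cn (KZero pos))))) (cn (KS a'));
      ax (if accepting q == verdict then CBot else CAnd (cn KLate) (cn (KG q a))) CBot] ++
  [seq ax (ex_role KP (CAnd (cn (KG q a)) (look m (CAnd (cn (KPos pos)) (cn (KS b))))))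
      (cn (KS b)) | b <- enum {: cell}].

(** The instantiation is at [size w], so the indexed [KI] labels the cells past the input, while
    [cn KI] has index 0 and starts the labelling. *)
Definition constant_axioms : seq axiom :=
  [:: ax (CName (var KI 0)) (cn (KS (blank M)));
      ax (CAnd (cn (KPos pos)) (ex_role KD (CName (var KI 0)))) (CName (var KI 0));
      ax CTop (cn (KZ time)); ax CTop (cn (KZ pos));
      ax (cn (KPos time)) (ex_role KP CTop);
      ax CTop (ex_role KD CTop); ax CTop (ex_role KE CTop);
      ax (cn (KZero time)) (cn (KQ (start M)));
      ax (CAnd (cn (KZero time)) (cn (KZero pos))) (cn KI)].

Definition soft_axiom : axiom := ((cn KU, CBot), Fin 1).

Definition final_block : seq axiom :=
  soft_axiom :: constant_axioms ++
  flatten [seq transition_axioms qa | qa <- enum {: state M * cell}].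

Definition u (b : bool) : ind_name := [:: b].

Definition the_abox : seq (assertion * weight) :=
  [:: (AConcept (nm KU 0) (u false), Inf); (AConcept (nm KU 0) (u true), Inf);
      (AConcept (nm (KF false) 0) (u false), Inf);
      (AConcept (nm (KF true) 0) (u true), Inf)].

Definition the_query : instance_query := QConcept (nm KAnswer 0) (TVar [::]).

(** * Assembly of the instance *)

Section Blocks.
Variables (BA BT : seq axiom) (BI : bool -> seq axiom) (BF : seq axiom).

Definition tbox_of (K : nat) (w : word) : seq axiom :=
  flatten [seq map (inst_axiom j) (keyed 0 BA) | j <- iota 0 K]
  ++ map (inst_axiom K) (keyed 1 BT)
  ++ flatten [seq map (inst_axiom i) (keyed 2 (BI (nth false w i))) | i <- iota 0 (size w)]
  ++ map (inst_axiom (size w)) (keyed 3 BF).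

Definition key_of (x : inclusion) : word := if x.2 is CAnd _ (CName y) then y else [::].

Lemma keys_keyed j b l :
  [seq key_of x.1 | x <- map (inst_axiom j) (keyed b l)] =
  [seq nm (KKey b r) j | r <- iota 0 (size l)].
Proof.
rewrite /keyed -!map_comp.
rewrite (eq_map (g := fun rx => nm (KKey b rx.1) j)); last first.
  by move=> rx /=; rewrite nm_cat.
rewrite (map_comp (fun r => nm (KKey b r) j) fst) -/unzip1.
by rewrite unzip1_zip // size_iota.
Qed.

(** The keys are pairwise distinct: block numbers separate the four parts, rank and index separate
    axioms within a part. Equal lengths of the letter blocks make the keys of the third part a
    product. *)
Lemma uniq_tbox_of a K w : (forall b, size (BI b) = a) -> uniq (unzip1 (tbox_of K w)).
Proof.
move=> size_BI; apply: (@map_uniq _ _ key_of).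
pose f (t : nat * nat * nat) := nm (KKey t.1.1 t.1.2) t.2.
have f_inj : injective f.
  by move=> [[b r] j] [[b' r'] j'] /nm_inj[[-> ->] /= ->].
pose blocks b n m := [seq ((b, r), j) | j <- iota 0 m, r <- iota 0 n] : seq (nat * nat * nat).
have -> : [seq key_of x | x <- unzip1 (tbox_of K w)] = map f
    (blocks 0 (size BA) K ++ [seq ((1, r), K) | r <- iota 0 (size BT)] ++
     blocks 2 a (size w) ++ [seq ((3, r), size w) | r <- iota 0 (size BF)]).
  rewrite /unzip1 -map_comp /tbox_of !map_cat !map_flatten.
  congr (_ ++ (_ ++ (_ ++ _))).
  - by congr flatten; rewrite -!map_comp; apply: eq_map => j /=; rewrite keys_keyed -map_comp.
  - by rewrite keys_keyed -map_comp.
  - by congr flatten; rewrite -!map_comp; apply: eq_map => j /=; rewrite keys_keyed size_BI -map_comp.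
  - by rewrite keys_keyed -map_comp.
rewrite map_inj_uniq //.
have ub b n m : uniq (blocks b n m).
  by apply: allpairs_uniq; rewrite ?iota_uniq // => -[? ?] [? ?] _ _ [-> ->].
have um b n m : uniq [seq ((b, r), m) | r <- iota 0 n].
  by rewrite (map_inj_uniq (f := fun r => ((b, r), m))) => [|? ? [] //]; exact: iota_uniq.
have mem_fst b n m t : t \in blocks b n m -> t.1.1 = b.
  by case/allpairsP=> ? [_ _ ->].
have mem_fst1 b n m t : t \in [seq ((b, r), m) | r <- iota 0 n] -> t.1.1 = b.
  by case/mapP=> ? _ ->.
have uniq_glue b (s1 s2 : seq (nat * nat * nat)) : (forall t, t \in s1 -> t.1.1 = b) ->
    (forall t, t \in s2 -> b < t.1.1) -> uniq s1 -> uniq s2 -> uniq (s1 ++ s2).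
  move=> h1 h2 u1 u2; rewrite cat_uniq u1 u2 andbT; apply/hasPn=> t /h2 lt.
  by apply/negP=> /h1 e; rewrite e ltnn in lt.
apply: (@uniq_glue 0); rewrite ?ub //; first exact: mem_fst.
  move=> t; rewrite !mem_cat => /orP[/mem_fst1->|/orP[/mem_fst->|/mem_fst1->]] //.
apply: (@uniq_glue 1); rewrite ?um //; first exact: mem_fst1.
  by move=> t; rewrite mem_cat => /orP[/mem_fst->|/mem_fst1->].
apply: (@uniq_glue 2); rewrite ?ub ?um //; first exact: mem_fst.
by move=> t /mem_fst1->.
Qed.

Lemma enc_tbox_of (tail : word) d w :
  enc_block (tbox_of ((size w + 2) ^ d) w) ++ tail =
  generated d (block_pieces (keyed 0 BA)) (block_pieces (keyed 1 BT))
    (fun b => block_pieces (keyed 2 (BI b)))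
    (block_pieces (keyed 3 BF) ++ lit tail) w.
Proof.
rewrite /generated expand_cat expand_lit; set K := (size w + 2) ^ d.
rewrite /tbox_of.
have enc_block_cat l l' : enc_block (l ++ l') = enc_block l ++ enc_block l'.
  by rewrite /enc_block map_cat flatten_cat.
have enc_block_flat l : enc_block (flatten l) = flatten (map enc_block l).
  by elim: l => //= x l IH; rewrite enc_block_cat IH.
rewrite !enc_block_cat !enc_block_flat -!catA.
congr (_ ++ (_ ++ (_ ++ (_ ++ _)))); rewrite ?expand_block //.
  by congr flatten; rewrite -map_comp; apply: eq_map => j; rewrite expand_block.
by congr flatten; rewrite -map_comp; apply: eq_map => j; rewrite expand_block.
Qed.

Lemma tbox_pos_of K w : all positive_weight (unzip2 BA) ->
  all positive_weight (unzip2 BT) -> (forall b, all positive_weight (unzip2 (BI b))) ->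
  all positive_weight (unzip2 BF) -> all positive_weight (unzip2 (tbox_of K w)).
Proof.
move=> pA pT pI pF.
have pos_block b l j : all positive_weight (unzip2 l) ->
    all positive_weight (unzip2 (map (inst_axiom j) (keyed b l))).
  move=> h; rewrite /unzip2 /keyed -!map_comp.
  rewrite (eq_map (g := snd \o snd)) // map_comp -[map snd (zip _ _)]/(unzip2 _).
  by rewrite unzip2_zip ?size_iota.
have all_flat (s : seq (seq weight)) :
    all (all positive_weight) s -> all positive_weight (flatten s).
  by elim: s => //= x s IH /andP[? ?]; rewrite all_cat IH ?andbT.
rewrite /tbox_of /unzip2 !map_cat !all_cat !map_flatten.
by rewrite pos_block // pos_block // !all_flat // !all_map; apply/allP=> j _ /=;
  rewrite pos_block.
Qed.

End Blocks.

Definition the_tbox := tbox_of bit_block top_block input_block final_block.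

Lemma uniq_the_tbox K w : uniq (unzip1 (the_tbox K w)).
Proof. by apply: (@uniq_tbox_of _ _ _ _ 2). Qed.

Lemma tbox_pos_the_tbox K w : all positive_weight (unzip2 (the_tbox K w)).
Proof.
have all_flat (s : seq (seq weight)) :
    all (all positive_weight) s -> all positive_weight (flatten s).
  by elim: s => //= x s IH /andP[? ?]; rewrite all_cat IH ?andbT.
apply: tbox_pos_of => //.
rewrite /unzip2 /= map_flatten; apply: all_flat.
rewrite !all_map; apply/allP=> -[q a] _ /=; rewrite /transition_axioms.
case: transition => -[q' a'] m /=.
by rewrite -map_comp all_map; apply/allP.
Qed.

Lemma uniq_the_abox : uniq (unzip1 the_abox).
Proof.
have uniq4 (x y z : word) : x <> y -> x <> z -> uniq [:: AConcept x (u false);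
    AConcept x (u true); AConcept y (u false); AConcept z (u true)].
  move=> /eqP/negPf xy /eqP/negPf xz.
  apply: (@map_uniq _ _ (fun al => if al is AConcept A a then (A, a) else ([::], [::]))).
  by rewrite /= !inE !xpair_eqE xy xz /= !andbF.
by apply: uniq4 => /nm_inj[].
Qed.

Definition the_wkb K w : wkb :=
  @WKB (the_tbox K w) the_abox (uniq_the_tbox K w) uniq_the_abox
    (tbox_pos_the_tbox K w) isT.

Lemma enc_seqE (T : Type) (e : T -> word) s :
  enc_seq e s = flatten [seq true :: e x | x <- s] ++ [:: false].
Proof. by elim: s => //= x s IH; rewrite /enc_seq /= -/(enc_seq e s) IH catA. Qed.

Definition final_word : word :=
  [:: false] ++ enc_seq (enc_pair enc_assertion (enc_weight c)) the_abox
    ++ enc_query the_query ++ enc_int c 2.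

(** What follows the inclusions is a constant word, so it joins the last template as literal
    pieces. *)
Lemma enc_instance_generated d w :
  enc_instance c (the_wkb ((size w + 2) ^ d) w) the_query 2 =
  generated d (block_pieces (keyed 0 bit_block)) (block_pieces (keyed 1 top_block))
    (fun b => block_pieces (keyed 2 (input_block b)))
    (block_pieces (keyed 3 final_block) ++ lit final_word) w.
Proof.
rewrite -enc_tbox_of /enc_instance /enc_wkb enc_seqE.
by rewrite /final_word -!catA.
Qed.

(** * The run of the machine on a cyclic tape *)

Section CyclicRun.
Variables (K : nat) (w : word).

Definition shift_mod (m : move) (p : nat) : nat :=
  match m with
  | MoveLeft => dec_mod K p
  | Stay => p
  | MoveRight => inc_mod K p
  end.

(* The tape of [M] rolled up on a cycle of length [2 ^ K], cell [0] being the
   scanned one. *)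
Fixpoint cyclic_run (t : nat) : state M * (nat -> symbol M) :=
  if t is t'.+1 then
    let: (q, s) := cyclic_run t' in
    let: (q', a, m) := transition q (s 0) in
    (q', fun p => if shift_mod m p == 0 then a else s (shift_mod m p))
  else (start M, nth (blank M) (map (bit M) w)).

(** The two tapes are compared only up to distance [2 ^ K.-1 - t] from the head: the effect of
    rolling up starts at the far side and comes closer by at most one cell per step. Cell [i] to the
    left has position [2 ^ K - i.+1]. *)
Definition agree (t : nat) (cfg : config M) : Prop :=
  let: (q, s) := cyclic_run t in
  let: Tape l a r := config_tapes cfg ord0 in
  [/\ config_state cfg = q,
      forall i, i + t <= 2 ^ K.-1 -> nth (blank M) (a :: r) i = s i &
      forall i, i.+1 + t <= 2 ^ K.-1 -> nth (blank M) l i = s (2 ^ K - i.+1)].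

(** The bound on [size w] makes the far half of the cycle blank at first, so that it can stand for
    the cells left of the head. *)
Lemma agree_run t : 0 < K -> size w <= 2 ^ K.-1 -> t <= 2 ^ K.-1 ->
  agree t (iter t (@step _ M) (init M w)).
Proof.
move=> K0 le_w; have e2 : 2 ^ K = 2 * 2 ^ K.-1 by rewrite -expnS prednK.
elim: t => [|t IH] let_.
  rewrite /agree /=; split=> // i lei.
    by case: (w) => [|b w'] //=; case: i {lei} => [|i] //=; rewrite !nth_nil.
  by rewrite nth_nil nth_default // size_map; lia.
have {IH} := IH (ltnW let_); rewrite iterS /agree /=.
set cfg := iter _ _ _; case e_run: (cyclic_run t) => [q s].
case e_tape: (config_tapes cfg ord0) => [l a r] [e_q e_r e_l].
have e_a : s 0 = a by rewrite -(e_r 0) // ltnW.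
have e_next : next cfg = delta q [ffun=> a].
  rewrite /next e_q; congr (delta _ _); apply/ffunP=> i.
  by rewrite !ffunE ord1 e_tape.
rewrite /step e_next /transition e_a.
case: (delta q [ffun=> a]) => [[q' f]|] /=; last first.
  rewrite e_tape; split=> // i lei.
    by rewrite e_r; [case: eqP => [->|_] | lia].
  rewrite e_l; last lia.
  by rewrite ifF //; lia.
rewrite e_tape; case: (f ord0) => b [] /=; rewrite /shift_mod.
- split=> // [[|i]|i] lei.
  + rewrite /= -nth0 e_l ?addn0; last lia.
    by rewrite /dec_mod /= ifF; [congr s|]; lia.
  + rewrite /= /dec_mod /=; case: i lei => [|i] lei //=.
    by rewrite -(e_r i.+1) //; lia.
  rewrite nth_behead e_l; last lia.
  have -> : dec_mod K (2 ^ K - i.+1) = 2 ^ K - i.+2 by rewrite /dec_mod ifF; lia.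
  by rewrite ifF //; lia.
- split=> // [[|i]|i] lei //.
    by rewrite /= -(e_r i.+1) //; lia.
  rewrite e_l; last lia.
  by rewrite ifF //; lia.
split=> // [i|[|i]] lei.
- have -> : nth (blank M) (head (blank M) r :: behead r) i = nth (blank M) r i.
    by case: (r) => //=; case: (i) => //= ?; rewrite nth_nil.
  have -> : inc_mod K i = i.+1 by rewrite /inc_mod ifF; lia.
  by rewrite -(e_r i.+1) //; lia.
- rewrite /=; have -> : inc_mod K (2 ^ K - 1) = 0 by rewrite /inc_mod ifT; lia.
  by [].
rewrite /= e_l; last lia.
have -> : inc_mod K (2 ^ K - i.+2) = 2 ^ K - i.+1 by rewrite /inc_mod ifF; lia.
by rewrite ifF //; lia.
Qed.

Lemma cyclic_run_state t : 0 < K -> size w <= 2 ^ K.-1 -> t <= 2 ^ K.-1 ->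
  (cyclic_run t).1 = config_state (iter t (@step _ M) (init M w)).
Proof.
move=> K0 le_w le_t; have := agree_run K0 le_w le_t; rewrite /agree.
by case: cyclic_run => q s; case: config_tapes => l a r [].
Qed.

(** Agreement is needed only at the halting instant [t]; from there on the cyclic run repeats its
    state by itself, also at times beyond the range of agreement. *)
Lemma cyclic_run_halted t t' : 0 < K -> size w <= 2 ^ K.-1 -> t <= 2 ^ K.-1 ->
  halted (iter t (@step _ M) (init M w)) -> t <= t' ->
  (cyclic_run t').1 = config_state (iter t (@step _ M) (init M w)).
Proof.
move=> K0 le_w le_t hlt le_t'.
(* The scanned symbol is included because the next transition depends on it. *)
have [e1 e2] : (cyclic_run t').1 = (cyclic_run t).1 /\
    (cyclic_run t').2 0 = (cyclic_run t).2 0; last first.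
  by rewrite e1 cyclic_run_state.
have := agree_run K0 le_w le_t; rewrite /agree.
case e_run: (cyclic_run t) => [q s]; set cfg := iter _ _ _ in hlt *.
case e_tape: (config_tapes cfg ord0) => [l a r] [e_q e_r _].
have e_a : s 0 = a by rewrite -(e_r 0).
have e_delta : delta q [ffun=> a] = None.
  move: hlt; rewrite /halted /next e_q.
  have -> : [ffun i => tape_head (config_tapes cfg i)] = [ffun=> a].
    by apply/ffunP=> i; rewrite !ffunE ord1 e_tape.
  by case: delta.
elim: t' le_t' => [|t' IH]; first by rewrite leqn0 => /eqP e; move: e_run; rewrite e => ->.
rewrite leq_eqVlt => /orP[/eqP e|]; first by move: e_run; rewrite e => ->.
rewrite ltnS => /IH /=; case: (cyclic_run t') => q' s' /= [-> ->].
by rewrite /transition e_a e_delta.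
Qed.

End CyclicRun.

Local Open Scope classical_set_scope.

(** * Satisfaction of the hard axioms, with and without keys *)

Definition holds (I : interp) (x : axiom) : Prop :=
  if x.2 is Inf then cext I x.1.1 `<=` cext I x.1.2 else True.

Lemma Alls_keyedW (P Q : axiom -> Prop) b l :
  (forall r x, Q (add_key b r x) -> P x) -> Alls Q (keyed b l) -> Alls P l.
Proof.
move=> h; rewrite /keyed Alls_map; elim: l 0 => [|x l IH] m //= [h1 /IH h2].
by split=> //; apply: h h1.
Qed.

Lemma Alls_keyedI (P Q : axiom -> Prop) b l :
  (forall r x, P x -> Q (add_key b r x)) -> Alls P l -> Alls Q (keyed b l).
Proof.
move=> h; rewrite /keyed Alls_map; elim: l 0 => [|x l IH] m //= [h1 /IH h2].
by split=> //; apply: h h1.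
Qed.

Lemma cext_dom I C : cext I C `<=` dom I.
Proof.
elim: C => [A|||C IHC D IHD|R C IHC] //= e.
- exact: cint_dom.
- by case=> /IHC.
- by case=> y [/rint_dom[]].
Qed.

Definition models (I : interp) (K : nat) (w : word) : Prop :=
  [/\ forall j, j < K -> Alls (holds I \o inst_axiom j) bit_block,
      Alls (holds I \o inst_axiom K) top_block,
      forall i, i < size w -> Alls (holds I \o inst_axiom i) (input_block (nth false w i)) &
      Alls (holds I \o inst_axiom (size w)) final_block].

(** The added conjuncts on the right-hand sides cost nothing when every key denotes the whole
    domain. *)
Lemma models_tbox (I : interp) K w :
  (forall b r j, cint I (nm (KKey b r) j) = dom I) ->
  models I K w -> Alls (holds I) (the_tbox K w).
Proof.
move=> key_dom [mA mT mI mF].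
have keyP b l j : Alls (holds I \o inst_axiom j) l ->
    Alls (holds I) (map (inst_axiom j) (keyed b l)).
  rewrite Alls_map; apply: Alls_keyedI => r x; rewrite /holds /=.
  case: x.2 => //= h e he; split; first exact: h.
  by rewrite nm_cat key_dom; apply: cext_dom he.
rewrite /the_tbox /tbox_of !Alls_cat !Alls_flatten !(Alls_map _ (Alls _)) !Alls_mem.
split=> [j|]; first by rewrite mem_iota => /andP[_ lt]; apply: keyP; apply: mA.
split; first exact: keyP.
split; last exact: keyP.
by move=> j; rewrite mem_iota => /andP[_ lt]; apply: keyP; apply: mI.
Qed.

Lemma tbox_models (I : interp) K w : Alls (holds I) (the_tbox K w) -> models I K w.
Proof.
have keyP b l j : Alls (holds I) (map (inst_axiom j) (keyed b l)) ->
    Alls (holds I \o inst_axiom j) l.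
  rewrite Alls_map; apply: Alls_keyedW => r x; rewrite /holds /=.
  by case: x.2 => //= h e /h[].
rewrite /the_tbox /tbox_of !Alls_cat !Alls_flatten !(Alls_map _ (Alls _)) !Alls_mem.
case=> mA [/keyP mT [mI /keyP mF]]; split=> // j lt.
  by apply/(@keyP 0)/mA; rewrite mem_iota.
by apply/(@keyP 2)/mI; rewrite mem_iota.
Qed.

Lemma Alls_final_block (P : axiom -> Prop) : Alls P final_block <->
  P soft_axiom /\ Alls P constant_axioms /\ forall qa, Alls P (transition_axioms qa).
Proof.
rewrite -[final_block]/([:: soft_axiom] ++ _) !Alls_cat Alls_flatten Alls_map Alls_mem.
split=> [[[hs _] [hc ht]]|[hs [hc ht]]]; do ?split=> //; last by move=> qa _.
by move=> qa; apply: ht; rewrite mem_enum.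
Qed.

(** * Models force the correct labels *)

Section Soundness.
Variables (I : interp) (K : nat) (w : word).
Hypothesis K0 : 0 < K.
Hypothesis mI : models I K w.
Hypothesis U_bound : forall x, cint I (nm KU 0) x -> exists b, x = inl (u b).
Hypothesis F_u : forall b, cint I (nm (KF b) 0) (inl (u b)).

Definition cbit k b j : concept := CEx (nm (KV k) j.+1) (CName (nm (KF b) 0)).

Definition bit_of k (e : elem I) (j : nat) : bool := `[< cext I (cbit k true j) e >].

Lemma inst_tbit k b j : inst j (tbit k b) = cbit k b j.
Proof. by rewrite /= nm_cat. Qed.

Lemma inst_tz k o j : inst j (tz k o) = CName (nm (KZ k) (o + j)).
Proof. by rewrite /= nm_cat. Qed.

Lemma inst_tn k o j : inst j (tn k o) = CName (nm (KN k) (o + j)).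
Proof. by rewrite /= nm_cat. Qed.

Lemma inst_cn x j : inst j (cn x) = CName (nm x 0).
Proof. by []. Qed.

Lemma inst_and C D j : inst j (CAnd C D) = CAnd (inst j C) (inst j D).
Proof. by []. Qed.

Lemma inst_ex_role R C j : inst j (ex_role R C) = CEx (nm R 0) (inst j C).
Proof. by []. Qed.

Lemma holds_ax j C D : holds I (inst_axiom j (ax C D)) <->
  (cext I (inst j C) `<=` cext I (inst j D)).
Proof. by []. Qed.

Definition inst_names :=
  (inst_tbit, inst_tz, inst_tn, inst_cn, inst_and, inst_ex_role).

Lemma bit_block_split j : j < K ->
  [/\ forall k, Alls (holds I \o inst_axiom j) (counter_axioms k),
      forall b, Alls (holds I \o inst_axiom j) (role_axioms b) & True].
Proof.
case: mI => mA _ _ _ /mA /Alls_cat[ct /Alls_cat[cp /Alls_cat[rt rf]]].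
by split=> [[]|[]|]; [exact: ct | exact: cp | exact: rt | exact: rf |].
Qed.

(** The [V]-successor lies in [KU], hence is one of the two individuals [u b], each of which is in
    its [KF b]. *)
Lemma bit_total k j e : j < K -> dom I e -> cext I (cbit k true j) e \/ cext I (cbit k false j) e.
Proof.
move=> /bit_block_split[/(_ k) /= [h _] _ _] /h /= [y [Vy /U_bound[b yb]]].
rewrite nm_cat in Vy; subst y.
by case: b Vy => Vy; [left|right]; eexists; (split; [exact: Vy | exact: F_u]).
Qed.

Lemma bit_excl k j e : j < K -> cext I (cbit k true j) e -> ~ cext I (cbit k false j) e.
Proof.
move=> /bit_block_split[/(_ k) [_ [h _]] _ _] e1 e2.
by move: h; rewrite /comp holds_ax !inst_names => /(_ e (conj e1 e2)).
Qed.

Lemma bitP k b j e : j < K -> dom I e -> cext I (cbit k b j) e <-> bit_of k e j = b.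
Proof.
move=> lt de; have [e1|e0] := bit_total k lt de.
  have -> : bit_of k e j = true by apply/asboolP.
  by case: b; split=> // e0; case: (bit_excl lt e1 e0).
have n1 : ~ cext I (cbit k true j) e by move=> /(bit_excl lt)/(_ e0).
have -> : bit_of k e j = false by apply/asboolP.
by case: b.
Qed.

(** Only membership in [Z] or [N] is derived, not absence from the other; the constraints on the
    roles need no more. *)
Lemma carryP k j e : j <= K -> dom I e ->
  if bits_val j (bit_of k e) == 0 then cint I (nm (KZ k) j) e
  else cint I (nm (KN k) j) e.
Proof.
elim: j => [|j IH] lt de.
  rewrite eqxx; case: mI => _ _ _ /Alls_final_block[_ [[_ [_ [ht [hp _]]]] _]].
  by case: k; [apply: ht | apply: hp].
have := IH (ltnW lt) de; rewrite bits_val_eq0.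
have [/(_ k) [_ [_ [hz [hn [hb _]]]]] _ _] := bit_block_split lt.
rewrite /comp !holds_ax !inst_names in hz hn hb.
have [_|_] := eqP => he /=; last exact: hn.
by case eb: (bit_of k e j) => /=; [apply: hb | apply: hz; split=> //]; apply/bitP.
Qed.

Lemma dec_roleP R k x y :
  (forall j b, j < K -> Alls (holds I \o inst_axiom j) (dec_axioms R k b)) ->
  rint I (nm R 0) (x, y) ->
  bits_val K (bit_of k y) = dec_mod K (bits_val K (bit_of k x)).
Proof.
move=> hR Rxy; have [dx dy] := rint_dom Rxy; apply: bits_val_dec => j lt.
have [+ [+ _]] := hR j (bit_of k x j) lt; rewrite /comp !holds_ax !inst_names.
have bx : cext I (cbit k (bit_of k x j) j) x by apply/bitP.
have := carryP k (ltnW lt) dx; case: eqP => _ hx hz hn.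
  apply/eqP/negPn/negP; rewrite addbT => ne; apply: (hz x); split; first by split.
  exists y; split=> //; apply/bitP => //; move: ne.
  by case: (bit_of k x j); case: (bit_of k y j).
apply/eqP/negPn/negP; rewrite addbF => ne; apply: (hn x); split; first by split.
exists y; split=> //; apply/bitP => //; move: ne.
by case: (bit_of k x j); case: (bit_of k y j).
Qed.

(** The axioms make [x] the decrement of [y], and [dec_modK] turns this around. *)
Lemma inc_roleP R k x y :
  (forall j b, j < K -> Alls (holds I \o inst_axiom j) (inc_axioms R k b)) ->
  rint I (nm R 0) (x, y) ->
  bits_val K (bit_of k y) = inc_mod K (bits_val K (bit_of k x)).
Proof.
move=> hR Rxy; have [dx dy] := rint_dom Rxy; apply/esym.
apply: dec_modK; first exact: bits_val_lt.
apply/esym; apply: bits_val_dec => j lt.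
have [+ [+ _]] := hR j (bit_of k y j) lt; rewrite /comp !holds_ax !inst_names.
have by_ : cext I (cbit k (bit_of k y j) j) y by apply/bitP.
have bx : cext I (cbit k (bit_of k x j) j) x by apply/bitP.
have := carryP k (ltnW lt) dy; case: eqP => _ hy hz hn.
  apply/eqP/negPn/negP; rewrite addbT => ne; apply: (hz x); split.
    by apply/bitP => //; move: ne; case: (bit_of k x j); case: (bit_of k y j).
  by exists y; split=> //; split.
apply/eqP/negPn/negP; rewrite addbF => ne; apply: (hn x); split.
  by apply/bitP => //; move: ne; case: (bit_of k x j); case: (bit_of k y j).
by exists y; split=> //; split.
Qed.

Lemma same_roleP R k x y :
  (forall j b, j < K -> Alls (holds I \o inst_axiom j) (same_axioms R k b)) ->
  rint I (nm R 0) (x, y) -> bits_val K (bit_of k y) = bits_val K (bit_of k x).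
Proof.
move=> hR Rxy; have [dx dy] := rint_dom Rxy; apply: bits_val_ext => j lt.
have [+ _] := hR j (bit_of k x j) lt; rewrite /comp !holds_ax !inst_names.
have bx : cext I (cbit k (bit_of k x j) j) x by apply/bitP.
move=> h; apply/eqP/negPn/negP => ne; apply: (h x); split=> //.
exists y; split=> //; apply/bitP => //; move: ne.
by case: (bit_of k x j); case: (bit_of k y j).
Qed.

Definition time_of e := bits_val K (bit_of time e).
Definition pos_of e := bits_val K (bit_of pos e).

Lemma roles x y :
  [/\ rint I (nm KP 0) (x, y) -> time_of y = dec_mod K (time_of x) /\ pos_of y = pos_of x,
      rint I (nm KD 0) (x, y) -> time_of y = time_of x /\ pos_of y = dec_mod K (pos_of x) &
      rint I (nm KE 0) (x, y) -> time_of y = time_of x /\ pos_of y = inc_mod K (pos_of x)].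
Proof.
have R j b : j < K -> _ := fun lt => let: And3 _ h _ := bit_block_split lt in h b.
have {}R j b (lt : j < K) : [/\ Alls (holds I \o inst_axiom j) (dec_axioms KP time b),
    Alls (holds I \o inst_axiom j) (same_axioms KP pos b),
    Alls (holds I \o inst_axiom j) (dec_axioms KD pos b) &
    Alls (holds I \o inst_axiom j) (same_axioms KD time b)] /\
    Alls (holds I \o inst_axiom j) (inc_axioms KE pos b) /\
    Alls (holds I \o inst_axiom j) (same_axioms KE time b).
  by have /Alls_cat[? /Alls_cat[? /Alls_cat[? /Alls_cat[? /Alls_cat[? ?]]]]] := R j b lt.
split=> Rxy; split.
- by apply: dec_roleP Rxy => j b /R-/(_ b)[[]].
- by apply: same_roleP Rxy => j b /R-/(_ b)[[]].
- by apply: same_roleP Rxy => j b /R-/(_ b)[[]].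
- by apply: dec_roleP Rxy => j b /R-/(_ b)[[]].
- by apply: same_roleP Rxy => j b /R-/(_ b)[_ []].
- by apply: inc_roleP Rxy => j b /R-/(_ b)[_ []].
Qed.

Lemma zeroP e : dom I e ->
  [/\ if time_of e == 0 then cint I (nm (KZero time) 0) e else cint I (nm (KPos time) 0) e &
      if pos_of e == 0 then cint I (nm (KZero pos) 0) e else cint I (nm (KPos pos) 0) e].
Proof.
move=> de; case: mI => _ [h1 [h2 [h3 [h4 _]]]] _ _.
rewrite /comp !holds_ax !inst_names in h1 h2 h3 h4.
have ht := carryP time (leqnn K) de; have hp := carryP pos (leqnn K) de.
by split; [move: ht|move: hp]; case: eqP => _; [apply: h1|apply: h2|apply: h3|apply: h4].
Qed.

Lemma inst_index x o j : inst j (CName (var x o)) = CName (nm x (o + j)).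
Proof. by rewrite /= nm_cat. Qed.

Lemma inst_top j : inst j CTop = CTop.
Proof. by []. Qed.

Lemma succD e : dom I e -> exists y, [/\ rint I (nm KD 0) (e, y), dom I y,
  time_of y = time_of e & pos_of y = dec_mod K (pos_of e)].
Proof.
case: mI => _ _ _ /Alls_final_block[_ [[_ [_ [_ [_ [_ [h _]]]]]] _]] /h [y [Ry _]]; exists y.
by have [_ /(_ Ry)[yt yp] _] := roles e y; have [_ dy] := rint_dom Ry.
Qed.

Lemma succE e : dom I e -> exists y, [/\ rint I (nm KE 0) (e, y), dom I y,
  time_of y = time_of e & pos_of y = inc_mod K (pos_of e)].
Proof.
case: mI => _ _ _ /Alls_final_block[_ [[_ [_ [_ [_ [_ [_ [h _]]]]]]] _]] /h [y [Ry _]]; exists y.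
by have [_ _ /(_ Ry)[yt yp]] := roles e y; have [_ dy] := rint_dom Ry.
Qed.

Lemma succP e t : dom I e -> time_of e = t.+1 ->
  exists y, [/\ rint I (nm KP 0) (e, y), dom I y, time_of y = t & pos_of y = pos_of e].
Proof.
move=> de et; have [+ _] := zeroP de; rewrite et /=.
case: mI => _ _ _ /Alls_final_block[_ [[_ [_ [_ [_ [h _]]]]] _]] /h [y [Ry _]]; exists y.
by have [/(_ Ry)[-> ->] _ _] := roles e y; have [_ dy] := rint_dom Ry; rewrite et.
Qed.

(** Induction on the position, along [D]. The minimum appears because the label of index [size w] is
    handed on unchanged. *)
Lemma input_label e : dom I e -> time_of e = 0 ->
  cint I (nm KI (minn (pos_of e) (size w))) e.
Proof.
move ep: (pos_of e) => p; elim: p e ep => [|p IH] e ep de et.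
  have [] := zeroP de; rewrite et ep /= min0n => ht hp.
  by case: mI => _ _ _ /Alls_final_block[_ [[_ [_ [_ [_ [_ [_ [_ [_ [h _]]]]]]]]] _]]; apply: h.
have [y [Ry dy yt yp]] := succD de; rewrite et in yt.
rewrite ep in yp; have := IH y yp dy yt.
have [_] := zeroP de; rewrite ep /= => hp.
case: mI => _ _ mIn /Alls_final_block[_ [[_ [hn _]] _]].
have [lt|ge] := ltnP p (size w); last first.
  rewrite (minn_idPr (leqW ge)) => hy.
  rewrite /comp holds_ax !inst_names !inst_index in hn; apply: hn; split=> //.
  by exists y.
rewrite (minn_idPl lt) => hy.
have [_ [h _]] := mIn p lt; rewrite /comp holds_ax !inst_names !inst_index in h.
by apply: h; split=> //; exists y.
Qed.

Lemma transition_model q a :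
  Alls (holds I \o inst_axiom (size w)) (transition_axioms (q, a)).
Proof.
by case: mI => _ _ _ /Alls_final_block[_ [_]].
Qed.

Definition labelled t := forall e, dom I e -> time_of e = t ->
  cint I (nm (KQ (cyclic_run K w t).1) 0) e /\
  cint I (nm (KS ((cyclic_run K w t).2 (pos_of e))) 0) e.

(** Induction on the position along [D], from the scanned cell at position 0 to all cells of the
    instant. *)
Lemma head_label t e : labelled t -> dom I e -> time_of e = t ->
  cint I (nm (KG (cyclic_run K w t).1 ((cyclic_run K w t).2 0)) 0) e.
Proof.
move=> lab; move ep: (pos_of e) => p.
have := transition_model (cyclic_run K w t).1 ((cyclic_run K w t).2 0).
rewrite /transition_axioms; case: transition => -[q' a'] m [h0 [h1 _]].
rewrite /comp !holds_ax !inst_names in h0 h1.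
elim: p e ep => [|p IH] e ep de et.
  have [hQ hS] := lab e de et; have [_] := zeroP de; rewrite ep in hS *.
  by move=> hZ; apply: h0.
have [y [Ry dy yt yp]] := succD de; rewrite et in yt; rewrite ep in yp.
have [_] := zeroP de; rewrite ep => hN; apply: h1; split=> //.
by exists y; split=> //; apply: IH.
Qed.

Lemma look_label m C e : dom I e ->
  exists y, [/\ dom I y, time_of y = time_of e, pos_of y = shift_mod K m (pos_of e) &
    cext I (inst (size w) C) y -> cext I (inst (size w) (look m C)) e].
Proof.
case: m => de /=.
- by have [y [Ry dy yt yp]] := succD de; exists y; split=> // h; exists y.
- by exists e.
by have [y [Ry dy yt yp]] := succE de; exists y; split=> // h; exists y.
Qed.

(** Induction on the time: a [P]-successor is at the previous instant and at the same position, and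
    the cell whose old symbol is needed is reached from it by the move. *)
Lemma labelledP t : labelled t.
Proof.
elim: t => [|t IH] e de et.
  have [ht _] := zeroP de; rewrite et /= in ht; split.
    by case: mI => _ _ _ /Alls_final_block[_ [[_ [_ [_ [_ [_ [_ [_ [h _]]]]]]]] _]]; apply: h.
  have := input_label de et; case: mI => _ _ mIn /Alls_final_block[_ [[hb _] _]].
  rewrite -[(cyclic_run K w 0).2]/(nth (blank M) (map (bit M) w)).
  rewrite /comp holds_ax !inst_names !inst_index in hb.
  have [lt|ge] := ltnP (pos_of e) (size w); last first.
    by move/hb; rewrite nth_default // size_map.
  rewrite (nth_map false) //.
  have [h _] := mIn _ lt; rewrite /comp holds_ax !inst_names !inst_index in h.
  exact: h.
have [y [Ry dy yt yp]] := succP de et.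
have hG := head_label IH dy yt.
rewrite /=; case e_run: (cyclic_run K w t) hG => [q s] /= hG.
rewrite /labelled e_run /= in IH.
have := transition_model q (s 0); rewrite /transition_axioms.
case: transition => -[q' a'] m /Alls_cat[[_ [_ [h2 [h3 _]]]] /Alls_map/Alls_mem h4].
rewrite /comp !holds_ax !inst_names in h2 h3; split.
  by apply: h2; exists y.
rewrite /=; have [z [dz zt zp]] := look_label m (cn (KZero pos)) dy.
have [_] := zeroP dz; rewrite -yp -zp; case: eqP => ez hz => [hl|_].
  by apply: h3; exists y; split=> //; split=> //; apply: hl.
(* The witness for this concept may differ from [z], but it has the same time and position. *)
have [z' [dz' zt' zp' hl']] := look_label m (CAnd (cn (KPos pos)) (cn (KS (s (pos_of z))))) dy.
have := h4 (s (pos_of z)); rewrite mem_enum /comp holds_ax !inst_names => /(_ isT); apply.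
exists y; split=> //; split=> //; apply: hl'; split.
  by have [_] := zeroP dz'; rewrite zp' -zp; case: eqP.
by have [_] := IH z' dz' (etrans zt' yt); rewrite zp' -zp.
Qed.

(** The individual [u true] is late and carries the label of its instant; with the unwanted verdict
    that label would be excluded. *)
Lemma model_verdict : exists2 t, 2 ^ K.-1 <= t & accepting (cyclic_run K w t).1 = verdict.
Proof.
pose e : elem I := inl (u true).
have de : dom I e by apply: cint_dom (F_u true).
case: mI => _ [_ [_ [_ [_ [h5 [h6 _]]]]]] _ _.
have [y [Vy Fy]] := h6 e (F_u true).
have hL : cint I (nm KLate 0) e by apply: h5; exists y.
have htop : bit_of time e K.-1.
  by apply/asboolP; exists y; split=> //; move: Vy; rewrite /= nm_cat prednK.
exists (time_of e).
  by have := bits_val_top htop; rewrite prednK.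
have hG := head_label (@labelledP (time_of e)) de erefl.
have := transition_model (cyclic_run K w (time_of e)).1 ((cyclic_run K w (time_of e)).2 0).
rewrite /transition_axioms; case: transition => -[q' a'] m [_ [_ [_ [_ [h _]]]]].
rewrite /comp holds_ax in h.
by case: ifP h => [/eqP|_ h] //; case: (h e).
Qed.
End Soundness.

(** * The canonical model *)

Definition dec_bits (b : nat -> bool) (i : nat) : bool := b i (+) (bits_val i b == 0).
(** The test says that all bits below [i] are set, so that a carry reaches bit [i]. *)
Definition inc_bits (b : nat -> bool) (i : nat) : bool :=
  b i (+) ((bits_val i b).+1 == 2 ^ i).

(** The bits below [i] are all zero after the increment iff they were all set before, so the
    decrement undoes each flip. This provides the [E]-successors. *)
Lemma inc_bitsK b : dec_bits (inc_bits b) = b.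
Proof.
have z i : (bits_val i (inc_bits b) == 0) = ((bits_val i b).+1 == 2 ^ i).
  elim: i => // i IH; rewrite bits_val_eq0 IH /inc_bits /=.
  have lt := bits_val_lt i b.
  by case: eqP => e; case: (b i) => /=; apply/esym/eqP; rewrite expnS; lia.
by apply/funext=> i; rewrite /dec_bits z /inc_bits -addbA addbb addbF.
Qed.

Section Canonical.
(* [ans] decides whether the fresh name of the query is full or empty. *)
Variables (K : nat) (w : word) (ans : bool).
Hypothesis K0 : 0 < K.
Hypothesis late_verdict : forall t, 2 ^ K.-1 <= t -> accepting (cyclic_run K w t).1 = verdict.

Local Notation bits := (nat -> bool).
Local Notation point := (ind_name + bits * bits)%type.

(** Bit sequences are infinite, but only the first [K] bits count. Individuals have all bits set,
    hence a late time, as the top block requires of [u true]. *)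
Definition point_bits (k : bool) (e : point) : bits :=
  match e with
  | inl _ => fun=> true
  | inr xy => if k then xy.1 else xy.2
  end.

Definition point_time e := bits_val K (point_bits time e).
Definition point_pos e := bits_val K (point_bits pos e).

Definition concept_meaning (x : kind) (j : nat) (e : point) : Prop :=
  match x with
  | KU => exists b, e = inl (u b)
  | KF b => e = inl (u b)
  | KZ k => bits_val j (point_bits k e) = 0
  | KN k => bits_val j (point_bits k e) <> 0
  | KZero k => bits_val K (point_bits k e) = 0
  | KPos k => bits_val K (point_bits k e) <> 0
  | KLate => point_bits time e K.-1
  | KI => point_time e = 0 /\ minn (point_pos e) (size w) = j
  | KQ q => q = (cyclic_run K w (point_time e)).1
  | KS a => a = (cyclic_run K w (point_time e)).2 (point_pos e)
  | KG q a => q = (cyclic_run K w (point_time e)).1 /\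
              a = (cyclic_run K w (point_time e)).2 0
  | KKey _ _ => True
  | KAnswer => ans
  | _ => False
  end.

(** [KP] starts only at positive times: wrapping around from time 0 would impose the labels of a
    later instant on the initial ones. [KE] is stated as a decrement from target to source, as in
    [inc_axioms]. *)
Definition role_meaning (x : kind) (j : nat) (e e' : point) : Prop :=
  match x with
  | KV k => if j is j'.+1 then e' = inl (u (point_bits k e j')) else False
  | KP => [/\ point_time e <> 0, point_bits time e' = dec_bits (point_bits time e) &
              point_bits pos e' = point_bits pos e]
  | KD => point_bits time e' = point_bits time e /\
          point_bits pos e' = dec_bits (point_bits pos e)
  | KE => point_bits time e' = point_bits time e /\
          point_bits pos e = dec_bits (point_bits pos e')
  | _ => False
  end.

Definition canonical : interp.
Proof.
apply: (@Interp (bits * bits)%type setT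
  (fun A => [set e | exists x j, A = nm x j /\ concept_meaning x j e])
  (fun A => [set e | exists x j, A = nm x j /\ role_meaning x j e.1 e.2])) => //.
by exists (inl (u true)).
Defined.

Lemma canonical_name x j :
  cext canonical (CName (nm x j)) = [set e | concept_meaning x j e].
Proof.
apply/seteqP; split=> e /=; last by exists x, j.
by move=> [y [i [/nm_inj[-> ->]]]].
Qed.

Lemma canonical_ex x j C :
  cext canonical (CEx (nm x j) C) =
  [set e | exists y, role_meaning x j e y /\ cext canonical C y].
Proof.
apply/seteqP; split=> e /= [y [h Cy]]; exists y; split=> //; last by exists x, j.
by case: h => z [i [/nm_inj[-> ->]]].
Qed.

Lemma canonical_bit k b j :
  cext canonical (cbit k b j) = [set e | point_bits k e j = b].
Proof.
rewrite /cbit canonical_ex canonical_name; apply/seteqP; split=> e /=.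
  by move=> [y [-> [->]]].
by move=> <-; exists (inl (u (point_bits k e j))).
Qed.

Lemma canonical_and C D : cext canonical (CAnd C D) = cext canonical C `&` cext canonical D.
Proof. by []. Qed.

Lemma canonical_top : cext canonical CTop = setT.
Proof. by []. Qed.

Lemma canonical_bot : cext canonical CBot = set0.
Proof. by []. Qed.

Definition canonicalE := (canonical_bit, canonical_name, canonical_ex,
  canonical_and, canonical_top, canonical_bot).

Lemma point_dec e e' k : point_bits k e' = dec_bits (point_bits k e) ->
  bits_val K (point_bits k e') = dec_mod K (bits_val K (point_bits k e)).
Proof. by move=> h; apply: bits_val_dec => j _; rewrite h. Qed.

Lemma role_P e e' : role_meaning KP 0 e e' ->
  point_time e = (point_time e').+1 /\ point_pos e' = point_pos e.
Proof.
move=> [ne /point_dec et ep]; rewrite /point_pos ep; split=> //.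
by rewrite /point_time et /dec_mod; case: eqP => //; rewrite /point_time in ne; lia.
Qed.

Lemma role_D e e' : role_meaning KD 0 e e' ->
  point_time e' = point_time e /\ point_pos e' = dec_mod K (point_pos e).
Proof. by move=> [et /point_dec ep]; rewrite /point_time et. Qed.

Lemma role_E e e' : role_meaning KE 0 e e' ->
  point_time e' = point_time e /\ point_pos e' = inc_mod K (point_pos e).
Proof.
move=> [et /point_dec ep]; rewrite /point_time et; split=> //.
by apply/esym/dec_modK; [exact: bits_val_lt | exact/esym].
Qed.

Lemma holds_axE (I : interp) j C D :
  (holds I \o inst_axiom j) (ax C D) = (cext I (inst j C) `<=` cext I (inst j D)).
Proof. by []. Qed.

Lemma canonical_counter k j : Alls (holds canonical \o inst_axiom j) (counter_axioms k).
Proof.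
rewrite /Alls /counter_axioms !holds_axE !inst_names; do 5?split => //.
- move=> e _; rewrite [inst _ _]/= nm_cat !canonicalE /=.
  by eexists; split=> //; eexists.
- by rewrite !canonicalE => e /= [->].
- by rewrite !canonicalE => e /= [-> ->].
- by rewrite !canonicalE => e /= h; lia.
by rewrite !canonicalE => e /= ->; have := expn_gt0 2 j; lia.
Qed.

Lemma canonical_dec R k b j :
  (forall e e', role_meaning R 0 e e' -> point_bits k e' = dec_bits (point_bits k e)) ->
  Alls (holds canonical \o inst_axiom j) (dec_axioms R k b).
Proof.
move=> h; rewrite /Alls /dec_axioms !holds_axE !inst_names; split; last split=> //.
  rewrite !canonicalE => e /= [[z eb] [y [/h ->]]].
  by rewrite /dec_bits eb; case: eqP => //; case: b {eb}.
rewrite !canonicalE => e /= [[z eb] [y [/h ->]]].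
by rewrite /dec_bits eb; case: eqP => //; case: b {eb}.
Qed.

Lemma canonical_inc R k b j :
  (forall e e', role_meaning R 0 e e' -> point_bits k e = dec_bits (point_bits k e')) ->
  Alls (holds canonical \o inst_axiom j) (inc_axioms R k b).
Proof.
move=> h; rewrite /Alls /inc_axioms !holds_axE !inst_names; split; last split=> //.
  rewrite !canonicalE => e /= [eb [y [/h ey [z yb]]]].
  by move: eb; rewrite ey /dec_bits yb; case: eqP => //; case: b {yb}.
rewrite !canonicalE => e /= [eb [y [/h ey [z yb]]]].
by move: eb; rewrite ey /dec_bits yb; case: eqP => //; case: b {yb}.
Qed.

Lemma canonical_same R k b j :
  (forall e e', role_meaning R 0 e e' -> point_bits k e' = point_bits k e) ->
  Alls (holds canonical \o inst_axiom j) (same_axioms R k b).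
Proof.
move=> h; rewrite /Alls /same_axioms !holds_axE !inst_names; split=> //.
rewrite !canonicalE => e /= [eb [y [/h ->]]]; rewrite eb.
by case: b {eb}.
Qed.

Lemma canonical_bit_block j : Alls (holds canonical \o inst_axiom j) bit_block.
Proof.
apply/Alls_cat; split; first exact: canonical_counter.
apply/Alls_cat; split; first exact: canonical_counter.
have R b : Alls (holds canonical \o inst_axiom j) (role_axioms b).
  apply/Alls_cat; split; first by apply: canonical_dec => e e' [].
  apply/Alls_cat; split; first by apply: canonical_same => e e' [].
  apply/Alls_cat; split; first by apply: canonical_dec => e e' [].
  apply/Alls_cat; split; first by apply: canonical_same => e e' [].
  apply/Alls_cat; split; first by apply: canonical_inc => e e' [].
  by apply: canonical_same => e e' [].
by apply/Alls_cat.
Qed.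

Lemma inst_var_ex x o j C : inst j (CEx (var x o) C) = CEx (nm x (o + j)) (inst j C).
Proof. by rewrite /= nm_cat. Qed.

Lemma canonical_top_block : Alls (holds canonical \o inst_axiom K) top_block.
Proof.
rewrite /Alls /top_block !holds_axE !inst_names !inst_var_ex !inst_names.
do 6?split => //; rewrite !canonicalE // => e /=; case: K K0 => // K' _.
  by move=> [y [-> []]].
by move=> ->; eexists; split; first reflexivity.
Qed.

Lemma canonical_input_block i : i < size w ->
  Alls (holds canonical \o inst_axiom i) (input_block (nth false w i)).
Proof.
move=> lt; rewrite /Alls /input_block !holds_axE !inst_names !inst_index !canonicalE.
do 2?split => //; move=> e /=.
  move=> [-> /= eqi]; have -> : point_pos e = i by lia.
  by rewrite (nth_map false).
move=> [ne [y [/role_D[-> ->] [-> eqi]]]]; split=> //.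
by move: ne eqi; rewrite -/(point_pos e) /dec_mod; case: eqP => //; lia.
Qed.

Lemma canonical_look m C e : cext canonical (inst (size w) (look m C)) e ->
  exists y, [/\ point_time y = point_time e, point_pos y = shift_mod K m (point_pos e) &
    cext canonical (inst (size w) C) y].
Proof.
case: m; rewrite /look ?inst_ex_role ?canonical_ex.
- by move=> [y [/role_D[et ep] h]]; exists y.
- by exists e.
by move=> [y [/role_E[et ep] h]]; exists y.
Qed.

(** The labels are exactly those of the cyclic run, so the deriving axioms express one step of it;
    the excluding axiom holds by [late_verdict]. *)
Lemma canonical_transition qa :
  Alls (holds canonical \o inst_axiom (size w)) (transition_axioms qa).
Proof.
case: qa => q a; rewrite /transition_axioms; case e_tr: (transition q a) => [[q' a'] m].
have run_next e : q = (cyclic_run K w (point_time e)).1 ->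
    a = (cyclic_run K w (point_time e)).2 0 ->
    cyclic_run K w (point_time e).+1 = (q', fun p =>
      if shift_mod K m p == 0 then a' else (cyclic_run K w (point_time e)).2 (shift_mod K m p)).
  by move=> /=; case: (cyclic_run K w _) => q0 s0 /= <- <-; rewrite e_tr.
apply/Alls_cat; split; last first.
  apply/Alls_map/Alls_mem => b _; rewrite /comp -/(comp _ _ _) holds_axE !inst_names.
  rewrite !canonicalE => e /= [y [/role_P[et ep] [[eq ea] /canonical_look[z [zt zp]]]]].
  rewrite !inst_names !canonicalE /= => -[ne ->].
  rewrite et (run_next y eq ea) /= -ep -zp; case: eqP => // _.
  by rewrite zt.
rewrite /Alls !holds_axE !inst_names; do 5?split => //.
- rewrite !canonicalE => e /= [ep [-> ->]]; split=> //.
  by rewrite /point_pos ep.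
- by rewrite !canonicalE => e /= [_ [y [/role_D[-> _]]]].
- by rewrite !canonicalE => e /= [y [/role_P[-> _] [eq ea]]]; rewrite (run_next y eq ea).
- rewrite !canonicalE => e /= [y [/role_P[et ep] [[eq ea] /canonical_look[z [zt zp]]]]].
  rewrite ?inst_names !canonicalE /= => ez.
  by rewrite et (run_next y eq ea) /= -ep -zp /point_pos ez.
case: ifP => [_ e []|na]; rewrite !inst_names !canonicalE => e /= [late [eq _]].
move: na; rewrite eq late_verdict ?eqxx //.
by have := bits_val_top late; rewrite prednK.
Qed.

Lemma canonical_final_block : Alls (holds canonical \o inst_axiom (size w)) final_block.
Proof.
apply/Alls_final_block; split=> //; split; last exact: canonical_transition.
rewrite /constant_axioms /Alls !holds_axE !inst_names !inst_index !inst_top.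
do 9?split => //; rewrite !canonicalE => e //=.
- by move=> [-> /= h]; rewrite nth_default // size_map; lia.
- move=> [ne [y [/role_D[-> ->] [-> h]]]]; split=> //.
  by move: ne h; rewrite -/(point_pos e) /dec_mod; case: eqP => //; lia.
- move=> ne; exists (inr (dec_bits (point_bits time e), point_bits pos e)).
  by split.
- by move=> _; exists (inr (point_bits time e, dec_bits (point_bits pos e))).
- move=> _; exists (inr (point_bits time e, inc_bits (point_bits pos e))).
  by rewrite /= inc_bitsK.
- by rewrite /point_time => ->.
by rewrite /point_time /point_pos => -[-> ->]; rewrite min0n.
Qed.

Lemma canonical_models : models canonical K w.
Proof.
split; [by move=> j _; apply: canonical_bit_block | exact: canonical_top_block
  | exact: canonical_input_block | exact: canonical_final_block].
Qed.

Lemma canonical_key b r j : cint canonical (nm (KKey b r) j) = dom canonical.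
Proof. by have /= -> := canonical_name (KKey b r) j; apply/seteqP. Qed.

Lemma canonical_answer e : cint canonical (nm KAnswer 0) e <-> ans.
Proof.
by split=> [[y [j [/nm_inj[<- _]]]]|h] //; exists KAnswer, 0.
Qed.
End Canonical.

(** * Costs *)

Lemma ecardE (T : Type) (A : set T) n : (A #= `I_n)%card -> ecard A = (n%:Z)%:E.
Proof.
move=> An; rewrite /ecard; case: pselect => [fA|[]]; last by exists n.
case: cid => m /= Am; congr (Posz _)%:E.
exact/card_eq_II/(card_eq_trans (card_esym Am)).
Qed.

Lemma ecard_set0 (T : Type) : ecard (@set0 T) = 0%E.
Proof. by apply: ecardE; rewrite II0 card_eq0. Qed.

Lemma ecard_ge0 (T : Type) (A : set T) : (0 <= ecard A)%E.
Proof. by rewrite /ecard; case: pselect => // fA; rewrite lee_fin. Qed.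

Lemma weight_ge0 x : (0 <= weight_value x)%E.
Proof. by case: x => [n|] //=; rewrite lee_fin. Qed.

Definition violation_cost (I : interp) (x : axiom) : \bar int :=
  (weight_value x.2 * ecard (vio I x.1))%E.

Lemma violation_cost_ge0 I x : (0 <= violation_cost I x)%E.
Proof. by rewrite mule_ge0 ?weight_ge0 ?ecard_ge0. Qed.

Lemma vio_eq0 I (x : axiom) : vio I x.1 = set0 <-> cext I x.1.1 `<=` cext I x.1.2.
Proof.
rewrite /vio; split=> [e0 e Ce|h].
  apply: contrapT => De; suff : set0 e by [].
  by rewrite -e0; split=> //; split=> //; apply: cext_dom Ce.
by rewrite -subset0 => e [/h De [_ /(_ De)]].
Qed.

Lemma ecard_eq0 (T : Type) (A : set T) : ecard A = 0%E -> A = set0.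
Proof.
rewrite /ecard; case: pselect => [fA|] //; case: cid => -[|n] //= An _.
by move: An; rewrite II0 card_eq0 => /eqP.
Qed.

(** An infinite weight times a positive number of violations is [+oo], above every finite bound. *)
Lemma violation_cost_Inf I (x : axiom) (r : int) : x.2 = Inf ->
  (violation_cost I x <= r%:E)%E -> cext I x.1.1 `<=` cext I x.1.2.
Proof.
rewrite /violation_cost => -> /= h; apply/vio_eq0/ecard_eq0.
apply/eqP; rewrite eq_le ecard_ge0 andbT leNgt; apply/negP=> gt0.
by move: h; rewrite gt0_mulye.
Qed.

Lemma sum_le_Alls (T : Type) (f : T -> \bar int) (s : seq T) (r : \bar int) :
  (forall x, 0 <= f x)%E -> (\sum_(x <- s) f x <= r)%E ->
  Alls (fun x => (f x <= r)%E) s.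
Proof.
move=> f0; elim: s => //= x s IH; rewrite big_cons => h.
have s0 : (0 <= \sum_(y <- s) f y)%E by apply: sume_ge0.
split; first by apply: le_trans h; rewrite leeDl.
by apply: IH; apply: le_trans h; rewrite leeDr.
Qed.

Lemma sum_eq0_Alls (T : Type) (f : T -> \bar int) (s : seq T) :
  Alls (fun x => f x = 0%E) s -> (\sum_(x <- s) f x = 0)%E.
Proof.
elim: s => [|x s IH] /=; first by rewrite big_nil.
by move=> [fx /IH e]; rewrite big_cons fx e adde0.
Qed.

Lemma cost_unfold K w I : cost (the_wkb K w) I =
  (\sum_(x <- the_tbox K w) violation_cost I x +
   \sum_(aw <- the_abox) if `[< ~ sat_assertion I aw.1 >] then weight_value aw.2 else 0)%E.
Proof. by rewrite /cost [X in (_ + X)%E]big_mkcond. Qed.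

(** A finite bound enforces everything of infinite weight. The two individuals asserted in [KU] then
    violate the soft axiom at cost 2, which leaves no room for a third element of [KU]. *)
Lemma cost_le_models K w I : (cost (the_wkb K w) I <= 2%:E)%E ->
  [/\ models I K w,
      forall x, cint I (nm KU 0) x -> exists b, x = inl (u b) &
      forall b, cint I (nm (KF b) 0) (inl (u b))].
Proof.
rewrite cost_unfold; set S1 := (X in (X + _)%E); set S2 := (X in (_ + X)%E) => le2.
have S1_0 : (0 <= S1)%E by apply: sume_ge0 => x _; apply: violation_cost_ge0.
have f0 (aw : assertion * weight) :
    (0 <= if `[< ~ sat_assertion I aw.1 >] then weight_value aw.2 else 0)%E.
  by case: ifP => _; [exact: weight_ge0 | exact: lexx].
have S2_0 : (0 <= S2)%E by apply: sume_ge0 => x _; apply: f0.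
have {}S1_2 : (S1 <= 2%:E)%E by apply: le_trans le2; rewrite leeDl.
have {le2}S2_2 : (S2 <= 2%:E)%E by apply: le_trans le2; rewrite leeDr.
have {S1_2}hT := sum_le_Alls (violation_cost_ge0 I) S1_2.
have {S2_2}hA := sum_le_Alls f0 S2_2.
have sat_inf al : ((if `[< ~ sat_assertion I al >] then +oo else 0) <= 2%:E :> \bar int)%E ->
    sat_assertion I al by case: asboolP => // /contrapT.
have [/sat_inf Uf [/sat_inf Ut [/sat_inf Ff [/sat_inf Ft _]]]] := hA.
split; last by case.
  apply: tbox_models; apply: Alls_imp hT => x h; rewrite /holds.
  by case e: x.2 => //; apply: violation_cost_Inf h.
move: hT; rewrite /the_tbox /tbox_of !Alls_cat => -[_ [_ [_ [hU _]]]] x Ux.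
move: hU; rewrite /violation_cost /= mul1e.
set A := vio _ _ => hA2.
have inA y : cint I (nm KU 0) y -> A y.
  by move=> Uy; split=> //; split; [apply: cint_dom Uy | case].
have Ax := inA _ Ux; have A0 := inA _ Uf; have A1 := inA _ Ut.
move: hA2; rewrite /ecard; case: pselect => // fA; case: cid => n /= An.
rewrite lee_fin => le_n.
(* The violating elements are numbered injectively below [n <= 2]; the two individuals use up both
   numbers, so [x] shares its number with one of them. *)
have /card_set_bijP[f [f_fun f_inj _]] := An.
have fx : f x < n by apply: f_fun.
have fu0 : f (inl (u false)) < n by apply: f_fun.
have fu1 : f (inl (u true)) < n by apply: f_fun.
have ne : f (inl (u false)) <> f (inl (u true)).
  by move/f_inj; rewrite !inE => /(_ A0 A1).
have : f x = f (inl (u false)) \/ f x = f (inl (u true)) by lia.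
by case=> /f_inj; rewrite !inE => /(_ Ax) h; [exists false; apply: h | exists true; apply: h].
Qed.

Section CanonicalCost.
Variables (K : nat) (w : word) (ans : bool).
Hypothesis K0 : 0 < K.
Hypothesis late_verdict : forall t, 2 ^ K.-1 <= t -> accepting (cyclic_run K w t).1 = verdict.
Local Notation I := (canonical K w ans).

Lemma violation_cost_eq0 (x : axiom) : x.2 = Inf -> holds I x -> violation_cost I x = 0%E.
Proof.
by rewrite /holds /violation_cost => -> /vio_eq0 ->; rewrite ecard_set0 mule0.
Qed.

Definition is_hard (x : axiom) : Prop := x.2 = Inf.

Lemma hard_keyed m b j l : Alls is_hard l ->
  Alls is_hard (map (inst_axiom j) [seq add_key b rx.1 rx.2 | rx <- zip (iota m (size l)) l]).
Proof. by elim: l m => //= x l IH m [hx /IH]. Qed.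

Lemma hard_transition qa : Alls is_hard (transition_axioms qa).
Proof.
case: qa => q a; rewrite /transition_axioms; case: (transition q a) => [[q' a'] m].
apply/Alls_cat; split; first by do 5?split.
by apply/Alls_map/Alls_mem.
Qed.

Lemma sum_hard_eq0 l : Alls is_hard l -> Alls (holds I) l ->
  (\sum_(x <- l) violation_cost I x = 0)%E.
Proof.
move=> hl ml; apply: sum_eq0_Alls.
by elim: l hl ml => //= x l IH [hx /IH hl] [mx /hl]; split=> //; apply: violation_cost_eq0.
Qed.

(** The soft axiom contributes one for each of the two individuals in [KU]; the rest of the block is
    hard and satisfied. *)
Lemma sum_final_block j : Alls (holds I) (map (inst_axiom j) (keyed 3 final_block)) ->
  (\sum_(x <- map (inst_axiom j) (keyed 3 final_block)) violation_cost I x = 2%:E)%E.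
Proof.
set rest := constant_axioms ++
  flatten [seq transition_axioms qa | qa <- enum {: state M * cell}].
have -> : map (inst_axiom j) (keyed 3 final_block) =
    inst_axiom j (add_key 3 0 soft_axiom) ::
    map (inst_axiom j) [seq add_key 3 rx.1 rx.2 | rx <- zip (iota 1 (size rest)) rest] by [].
move=> [_ mr]; rewrite big_cons sum_hard_eq0 //; last first.
  apply: hard_keyed; rewrite /rest; apply/Alls_cat; split; first by do 9?split.
  by apply/Alls_flatten/Alls_map/Alls_mem => qa _; apply: hard_transition.
rewrite adde0 /violation_cost /= mul1e.
have -> : vio I (inst_axiom j (add_key 3 0 soft_axiom)).1 =
    [set inl (u false); inl (u true)].
  rewrite /vio /=; apply/seteqP; split=> e /=.
    by case=> -[x [i [/nm_inj[<- _] [b ->]]]] _; case: b; [right|left].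
  move=> h; split; last by split=> // -[].
  by exists KU, 0; split=> //; case: h => ->; [exists false | exists true].
pose f (e : elem I) : nat := `[< e = inl (u true) >].
have f0 : f (inl (u false)) = 0 by rewrite /f; case: asboolP => // -[].
have f1 : f (inl (u true)) = 1 by rewrite /f; case: asboolP.
apply: (@ecardE _ _ 2); apply/card_set_bijP; exists f; split.
- by move=> e [->|->]; rewrite ?f0 ?f1.
- by move=> e e'; rewrite !inE /= => -[->|->] [->|->]; rewrite ?f0 ?f1.
move=> [|[|]] // _; [exists (inl (u false)) | exists (inl (u true))] => //.
  by left.
by right.
Qed.

Lemma canonical_cost : (cost (the_wkb K w) I <= 2%:E)%E.
Proof.
have hT := models_tbox (canonical_key K w ans) (canonical_models ans K0 late_verdict).
rewrite cost_unfold [X in (_ + X)%E]sum_eq0_Alls; last first.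
  rewrite /Alls /the_abox; do 4?split => //; case: asboolP => // -[] /=.
  - by exists KU, 0; split=> //; exists false.
  - by exists KU, 0; split=> //; exists true.
  - by exists (KF false), 0.
  - by exists (KF true), 0.
rewrite adde0; move: hT; rewrite /the_tbox /tbox_of => /Alls_cat[mA /Alls_cat[mT]].
move=> /Alls_cat[mW mF]; rewrite !big_cat sum_final_block //.
have hard_role b : Alls is_hard (role_axioms b) by do 13?split.
have hard b j l : Alls is_hard l -> Alls is_hard (map (inst_axiom j) (keyed b l)).
  exact: hard_keyed.
rewrite !sum_hard_eq0 // ?add0e //.
  by apply/Alls_flatten/Alls_map/Alls_mem => i _; rewrite /comp; apply: hard; do 3?split.
apply/Alls_flatten/Alls_map/Alls_mem => i _; rewrite /comp; apply: hard.
apply/Alls_cat; split; first by do 6?split.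
apply/Alls_cat; split; first by do 6?split.
by apply/Alls_cat; split; apply: hard_role.
Qed.
End CanonicalCost.

(** With the wanted verdict, the canonical model with [ans] true witnesses possibility and the one
    with [ans] false refutes certainty. Otherwise no interpretation is within the bound, and
    certainty is vacuous. *)
Lemma reduction_correct K w t : 0 < K -> size w <= 2 ^ K.-1 -> t <= 2 ^ K.-1 ->
  halted (iter t (@step _ M) (init M w)) ->
  let ok := accepting (config_state (iter t (@step _ M) (init M w))) = verdict in
  (possible (the_wkb K w) the_query 2 <-> ok) /\ (certain (the_wkb K w) the_query 2 <-> ~ ok).
Proof.
move=> K0 le_w le_t hlt ok.
have late t' : 2 ^ K.-1 <= t' -> (accepting (cyclic_run K w t').1 = verdict) = ok.
  by move=> le_t'; rewrite (cyclic_run_halted K0 le_w le_t hlt) // (leq_trans le_t).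
have ok_of I : (cost (the_wkb K w) I <= 2%:E)%E -> ok.
  move=> /cost_le_models[mI U F].
  by have [t' /late <-] := model_verdict K0 mI U F.
have of_ok ans : ok -> (cost (the_wkb K w) (canonical K w ans) <= 2%:E)%E.
  by move=> hok; apply: canonical_cost => // t' /late ->.
have query ans : sat_query (canonical K w ans) the_query <-> ans.
  split=> [[v [_ /canonical_answer]]|h] //.
  by exists (fun=> inl [::]); split=> //; apply/canonical_answer.
split; split.
- by move=> [I [_ /ok_of]].
- by move=> hok; exists (canonical K w true); split=> //; [apply: of_ok | apply/query].
- move=> cert hok; have := cert (canonical K w false).
  by move=> /(_ (fun _ _ => Logic.I) (of_ok false hok)) /query.
by move=> nok I _ /ok_of.
Qed.

End Reduction.

(** * The polynomial-time reductions *)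

Lemma polytime_reduction M c verdict d : polytime_computable (fun w =>
  enc_instance c (the_wkb M verdict ((size w + 2) ^ d) w) (the_query M) 2).
Proof.
rewrite (_ : (fun w => _) = generated d (block_pieces c (keyed M 0 (bit_block M)))
    (block_pieces c (keyed M 1 (top_block M)))
    (fun b => block_pieces c (keyed M 2 (input_block M b)))
    (block_pieces c (keyed M 3 (final_block M verdict)) ++ lit (final_word M c))).
  exact: polytime_generated.
by apply/funext=> w; apply: enc_instance_generated.
Qed.

(** With [K = (n + 2) ^ d.+1] bits the running time [2 ^ (n ^ d + d)] is at most [2 ^ K.-1], half
    the length of the cycle. *)
Lemma exponent_bound n d : n ^ d + d < (n + 2) ^ d.+1.
Proof.
have h : d < 2 ^ d by apply: ltn_expl.
have h1 : n ^ d <= (n + 2) ^ d by case: d {h} => // d; rewrite leq_exp2r ?leq_addr.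
have h2 : 2 ^ d <= (n + 2) ^ d by case: d {h h1} => // d; rewrite leq_exp2r ?leq_addl.
by rewrite expnS; nia.
Qed.

Theorem theorem5 (c : numeral) :
  EXPTIME_hard (possible_problem c) /\ EXPTIME_hard (certain_problem c).
Proof.
have reduction L : EXPTIME L -> exists (M : tm 0) d, forall w,
    let K := (size w + 2) ^ d in exists acc : bool, (L w <-> acc) /\
    forall verdict,
      (possible (the_wkb M verdict K w) (the_query M) 2 <-> acc = verdict) /\
      (certain (the_wkb M verdict K w) (the_query M) 2 <-> acc <> verdict).
  move=> [M [d dec]]; exists M, d.+1 => w K.
  have ltK : size w ^ d + d < K by apply: exponent_bound.
  have ltw : size w < K.
    by rewrite /K expnS; have := expn_gt0 (size w + 2) d; nia.
  have K0 : 0 < K by apply: leq_ltn_trans ltK.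
  have [cfg [ecfg hlt] Lw] := dec w; exists (accepting (config_state cfg)).
  split=> // verdict; rewrite ecfg; apply: reduction_correct => //.
  - by apply: ltnW; apply: leq_ltn_trans (ltn_expl _ _) => //; lia.
  - by rewrite leq_exp2l //; lia.
  by rewrite -ecfg.
(* Possibility is reduced to with acceptance as the wanted verdict, certainty with rejection: it
   holds when no model of a rejecting run exists, that is, when the machine accepts. *)
split=> L /reduction[M [d red]].
  exists (fun w => enc_instance c (the_wkb M true ((size w + 2) ^ d) w) (the_query M) 2).
    exact: polytime_reduction.
  move=> w; have [acc [-> /(_ true)[hp _]]] := red w.
  (* Any instance with this code is the constructed one, by injectivity of the encoding. *)
  split=> [/hp|[K [q [k [/enc_instance_inj[<- <- <-] /hp]]]]] //.
  by exists (the_wkb M true ((size w + 2) ^ d) w), (the_query M), 2%Z.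
exists (fun w => enc_instance c (the_wkb M false ((size w + 2) ^ d) w) (the_query M) 2).
  exact: polytime_reduction.
move=> w; have [acc [-> /(_ false)[_ hc]]] := red w.
have {}hc : certain (the_wkb M false ((size w + 2) ^ d) w) (the_query M) 2 <-> acc.
  by rewrite hc; case: (acc); split.
split=> [/hc|[K [q [k [/enc_instance_inj[<- <- <-] /hc]]]]] //.
by exists (the_wkb M false ((size w + 2) ^ d) w), (the_query M), 2%Z.
Qed.
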